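(* Let $u\in h^2(\mathbb{C}_+)$, let $f$ be its boundary function on $\mathbb{R}$, and let $F$ be the canonical holomorphic function in $\mathbb{C}_+$ with real part $u$. Then (as equalities in $[0,+\infty]$) $$\int_{\mathbb{C}_+}|\nabla u|^2\,d\sigma=2\pi\int_{-\infty}^{+\infty}|t|\,|\hat f(t)|^2\,dt=\int_{\mathbb{C}_+}|F'(z)|^2\,d\sigma=\frac{1}{2\pi}\int_{-\infty}^{+\infty}\int_{-\infty}^{+\infty}\frac{|f(x_1)-f(x_2)|^2}{|x_1-x_2|^2}\,dx_1\,dx_2.$$
   Context: $\mathbb{C}_+=\{x+\mathbf{i}y: x\in\mathbb{R},\ y>0\}$ is the upper half plane and $d\sigma$ is area measure. $h^2(\mathbb{C}_+)$ is the set of real-valued harmonic functions $u$ on $\mathbb{C}_+$ with $\sup_{y>0}\int_{-\infty}^{\infty}|u(x+\mathbf{i}y)|^2dx<\infty$. Each such $u$ is the Poisson integral of a unique $f\in L^2(\mathbb{R})$, its boundary function, $u(x+\mathbf{i}y)=\frac1\pi\int_{\mathbb{R}}\frac{y}{y^2+(x-t)^2}f(t)\,dt$, and $u(x+\mathbf{i}y)\to f(x)$ a.e. as $y\to0^+$. The canonical holomorphic function is $F=u+\mathbf{i}v$, where $v$ is a harmonic conjugate of $u$ in $\mathbb{C}_+$ (the additive normalization of $v$ does not affect $F'$). The Fourier transform is $\hat f(t)=\int_{-\infty}^{\infty}e^{2\pi\mathbf{i}xt}f(x)\,dx$, extended to $L^2(\mathbb{R})$ as usual. *)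

(* Defs.v *)
From HB Require Import structures.
From mathcomp Require Import all_boot all_order all_algebra.
From mathcomp Require Import all_classical all_reals all_analysis.
From mathcomp Require Import complex.

Set Implicit Arguments.
Unset Strict Implicit.
Unset Printing Implicit Defensive.

Import Order.TTheory GRing.Theory Num.Theory.
Import numFieldNormedType.Exports.

Local Open Scope classical_set_scope.
Local Open Scope ring_scope.
Local Open Scope complex_scope.

Section HalfPlane.
Variable R : realType.

Definition upper_half_plane : set R[i] := [set z | 0 < complex.Im z].

(* The product space [R * R] carries the topology and the area measure. *)
Definition of_pair (p : R * R) : R[i] := p.1 +i* p.2.

Definition area_integral (D : set R[i]) (g : R[i] -> R) : \bar R :=
  (\int[lebesgue_measure \x lebesgue_measure]_(p in of_pair @^-1` D)
     (g (of_pair p))%:E)%E.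

Definition partial_x (u : R[i] -> R) (z : R[i]) : R :=
  derive1 (fun x : R => u (x +i* complex.Im z)) (complex.Re z).

Definition partial_y (u : R[i] -> R) (z : R[i]) : R :=
  derive1 (fun y : R => u (complex.Re z +i* y)) (complex.Im z).

Definition grad_norm_sq (u : R[i] -> R) (z : R[i]) : R :=
  partial_x u z ^+ 2 + partial_y u z ^+ 2.

Definition C1_on (D : set R[i]) (u : R[i] -> R) : Prop :=
  forall x y : R, D (x +i* y) ->
    [/\ derivable (fun s : R => u (s +i* y)) x 1,
        derivable (fun s : R => u (x +i* s)) y 1,
        {for (x, y), continuous (partial_x u \o of_pair)} &
        {for (x, y), continuous (partial_y u \o of_pair)}].

Definition harmonic_on (D : set R[i]) (u : R[i] -> R) : Prop :=
  [/\ C1_on D u, C1_on D (partial_x u), C1_on D (partial_y u) &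
      forall z, D z ->
        partial_x (partial_x u) z + partial_y (partial_y u) z = 0].

(* [R[i]] is used as a normed space over itself, so [derivable _ z 1] and
   [derive1] refer to the complex difference quotient. *)
Definition holomorphic_on (D : set R[i]) (F : R[i] -> R[i]) : Prop :=
  forall z, D z -> derivable (F : (R[i])^o -> (R[i])^o) z 1.

Definition complex_derive (F : R[i] -> R[i]) : R[i] -> R[i] :=
  derive1 (F : (R[i])^o -> (R[i])^o).

Definition harmonic_conjugate (D : set R[i]) (u v : R[i] -> R) : Prop :=
  harmonic_on D v /\ holomorphic_on D (fun z => u z +i* v z).

Definition canonical_holomorphic (u : R[i] -> R) (F : R[i] -> R[i]) : Prop :=
  exists2 v : R[i] -> R, harmonic_conjugate upper_half_plane u v &
    forall z, upper_half_plane z -> F z = u z +i* v z.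

Definition h2 (u : R[i] -> R) : Prop :=
  harmonic_on upper_half_plane u /\
  (ereal_sup [set \int[lebesgue_measure]_x ((`|u (x +i* y)| ^+ 2)%:E)
             | y in [set y : R | (0 < y)%R]] < +oo)%E.

Definition poisson_integral (f : R -> R) (x y : R) : R :=
  pi^-1 * \int[lebesgue_measure]_t (y / (y ^+ 2 + (x - t) ^+ 2) * f t).

Definition boundary_function (u : R[i] -> R) (f : R -> R) : Prop :=
  f \in Lfun lebesgue_measure 2%:E /\
  forall x y : R, 0 < y -> u (x +i* y) = poisson_integral f x y.

(* For real-valued [f], the real and imaginary parts of the integral of
   [e^(2 pi i x t) f(x)] with respect to [x]. *)
Definition fourierL1 (f : R -> R) (t : R) : R[i] :=
  (\int[lebesgue_measure]_x (cos (2 * pi * x * t) * f x)) +i*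
  (\int[lebesgue_measure]_x (sin (2 * pi * x * t) * f x)).

(* [fh] is (a representative of) the Fourier transform of [f] in L^2, the
   continuous extension of [fourierL1] from the intersection of L^1 and L^2:
   the pair [(f, fh)] is an L^2 limit of pairs [(phi n, fourierL1 (phi n))]. *)
Definition is_fourier_transform (f : R -> R) (fh : R -> R[i]) : Prop :=
  [/\ f \in Lfun lebesgue_measure 2%:E,
      (fun t => complex.Re (fh t)) \in Lfun lebesgue_measure 2%:E,
      (fun t => complex.Im (fh t)) \in Lfun lebesgue_measure 2%:E &
      exists phi : nat -> R -> R,
        [/\ forall n, phi n \in Lfun lebesgue_measure 1,
            forall n, phi n \in Lfun lebesgue_measure 2%:E,
            (\int[lebesgue_measure]_x ((`|phi n x - f x| ^+ 2)%:E))%E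
              @[n --> \oo] --> 0%E &
            (\int[lebesgue_measure]_t
               ((Normc.normc (fourierL1 (phi n) t - fh t) ^+ 2)%:E))%E
              @[n --> \oo] --> 0%E]].

End HalfPlane.

Arguments upper_half_plane : clear implicits.

(* Main.v *)
Require Import Defs.
From HB Require Import structures.
From mathcomp Require Import all_boot all_order all_algebra.
From mathcomp Require Import all_classical all_reals all_analysis.
From mathcomp Require Import complex.
From mathcomp Require Import measurable_realfun ring lra.

(** For real functions the Fourier transform is replaced by the real Hartley
    transform [H f t = \int cas (2 pi x t) f x dx], [cas = cos + sin], which is
    the sum of the real and imaginary parts of the Fourier transform.  These
    parts are even and odd, so [(H f)^2] and [|f^|^2] have the same integral
    against every even weight.

    Plancherel for [H] on [L1] and [L2] is obtained by Abel summation: damping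
    [(H f)^2] by [exp (- 2 pi y |t|)] gives [\iint P_y (x - x') f x f x'], that
    is [\int f^2 - 1/2 \int P_y h * |f (. + h) - f|_2^2 dh], and the last term
    vanishes as [y] tends to [0] because translations are continuous in [L2].

    In the upper half plane [u (x + i y) = \int exp (- 2 pi y |t|) cas (2 pi x t)
    eta t dt], where [eta] is the transform of [f].  Differentiating under the
    integral sign and applying Plancherel on each horizontal line gives
    [\int |grad u|^2 dx = 2 \int (2 pi t)^2 exp (- 4 pi y |t|) eta^2 dt], and
    integrating in [y] yields [2 pi \int |t| eta^2].  The double integral of
    difference quotients is [\int |f (. + h) - f|_2^2 / h^2 dh], where
    [|f (. + h) - f|_2^2 = \int 4 sin (pi t h)^2 eta^2 dt]; Tonelli reduces it to
    [\int sin (pi t h)^2 / h^2 dh = pi^2 |t|], which is itself Plancherel for the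
    indicator function of an interval.  Finally [|F'|^2 = |grad u|^2] by the
    Cauchy-Riemann equations. *)
Set Implicit Arguments.
Unset Strict Implicit.
Unset Printing Implicit Defensive.

Import Order.TTheory GRing.Theory Num.Theory.
Import numFieldNormedType.Exports.

Local Open Scope classical_set_scope.
Local Open Scope ring_scope.
Local Open Scope complex_scope.

(** Real transforms keep every integral real-valued. The price is a reflection: since
    [cas' s = cas (- s)], translations and the [x]-derivative bring in the value at [- t].
    Reflection preserves Lebesgue measure and [|t|], so it disappears from every norm; differences
    are centered so that nothing but the reflected value remains.

    For [f] merely in L2 the transform [eta] exists only as a limit, without a pointwise formula.
    Just two facts about [f] and [eta] are carried through that limit: the pairing with a fixed L2
    function, which gives the Poisson formula, and the squared norm, which gives Plancherel for
    differences.

    At a height [y > 0] the damping factor puts the densities of both partial derivatives in L1 as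
    well as L2. Their transforms are then genuine integrals, and Plancherel on the intersection of
    L1 and L2 applies to them without a limit.

    The energy may be infinite, so the final identities are obtained by Tonelli on nonnegative
    integrands, and a cross term is never integrated alone. *)

Section L2_functions.
Context d (T : measurableType d) (R : realType) (mu : {measure set T -> \bar R}).
Implicit Types (f g : T -> R) (k : T -> R).

Definition L1 (f : T -> R) := mu.-integrable [set: T] (EFin \o f).

Definition N2 (f : T -> R) : \bar R := (\int[mu]_x (f x ^+ 2)%:E)%E.

Definition L2 (f : T -> R) := measurable_fun [set: T] f /\ (N2 f < +oo)%E.

Lemma L1_measurable f : L1 f -> measurable_fun [set: T] f.
Proof. by case/integrableP => /measurable_EFinP. Qed.

Lemma le_L1 f g : measurable_fun [set: T] f -> (forall x, `|f x| <= g x) ->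
  L1 g -> L1 f.
Proof.
move=> mf fg; apply: le_integrable => //; first exact/measurable_EFinP.
by move=> x _ /=; rewrite lee_fin (le_trans (fg x))// ler_norm.
Qed.

Lemma L1D f g : L1 f -> L1 g -> L1 (fun x => f x + g x).
Proof. by move=> lf lg; exact: (integrableD _ lf lg). Qed.

Lemma L1B f g : L1 f -> L1 g -> L1 (fun x => f x - g x).
Proof. by move=> lf lg; exact: (integrableB _ lf lg). Qed.

Lemma L1Z (k : R) f : L1 f -> L1 (fun x => k * f x).
Proof. by move=> lf; exact: (integrableZl _ k lf). Qed.

Lemma L1_norm f : L1 f -> L1 (fun x => `|f x|).
Proof. by move=> lf; exact: (integrable_abse lf). Qed.

Lemma L1_bdd k M f : measurable_fun [set: T] k -> (forall x, `|k x| <= M) ->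
  L1 f -> L1 (fun x => k x * f x).
Proof.
move=> mk kM lf; apply: (@le_L1 _ (fun x => M * `|f x|)).
- by apply: measurable_funM => //; exact: L1_measurable.
- by move=> x; rewrite normrM ler_wpM2r.
- exact/L1Z/L1_norm.
Qed.

Lemma N2_ge0 f : (0 <= N2 f)%E.
Proof. by apply: integral_ge0 => x _; rewrite lee_fin sqr_ge0. Qed.

Lemma measurable_sqr f : measurable_fun [set: T] f ->
  measurable_fun [set: T] (fun x => f x ^+ 2).
Proof. by move=> mf; exact: measurable_funX. Qed.

Lemma L2_sqr f : L2 f -> L1 (fun x => f x ^+ 2).
Proof.
case=> mf ff; apply/integrableP; split.
  exact/measurable_EFinP/measurable_sqr.
rewrite (le_lt_trans _ ff)// /N2; apply: ge0_le_integral => //.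
- by apply/measurable_EFinP; apply: measurableT_comp => //; exact: measurable_sqr.
- exact/measurable_EFinP/measurable_sqr.
- by move=> x _; rewrite /= ger0_norm ?sqr_ge0.
Qed.

Lemma N2E f : L2 f -> N2 f = (\int[mu]_x (f x ^+ 2))%:E.
Proof.
by move=> /L2_sqr lf; rewrite /Rintegral fineK//; exact: integrable_fin_num.
Qed.

Lemma sqr_L2 f : measurable_fun [set: T] f -> L1 (fun x => f x ^+ 2) -> L2 f.
Proof.
move=> mf /integrableP[_ h]; split=> //; apply: le_lt_trans h.
apply: ge0_le_integral => //.
- by move=> x _; rewrite lee_fin sqr_ge0.
- exact/measurable_EFinP/measurable_sqr.
- by apply/measurable_EFinP; apply: measurableT_comp => //; exact: measurable_sqr.
- by move=> x _; rewrite /= lee_fin ler_norm.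
Qed.

Lemma le_L2 f g : measurable_fun [set: T] f -> (forall x, `|f x| <= `|g x|) ->
  L2 g -> L2 f.
Proof.
move=> mf fg l2g; apply: sqr_L2 => //; apply: le_L1 (L2_sqr l2g).
  exact: measurable_sqr.
move=> x; rewrite normrX -[leRHS]ger0_norm ?sqr_ge0// normrX.
by rewrite ler_sqr ?nnegrE.
Qed.

Lemma L2D f g : L2 f -> L2 g -> L2 (fun x => f x + g x).
Proof.
move=> l2f l2g; have [[mf _] [mg _]] := (l2f, l2g).
apply: sqr_L2; first exact: measurable_funD.
apply: (@le_L1 _ (fun x => 2 * f x ^+ 2 + 2 * g x ^+ 2)).
- by apply: measurable_sqr; exact: measurable_funD.
- move=> x; rewrite ger0_norm ?sqr_ge0//.
  by have := sqr_ge0 (f x - g x); nra.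
- by apply: L1D; apply/L1Z/L2_sqr.
Qed.

Lemma L2_bdd k M f : measurable_fun [set: T] k -> (forall x, `|k x| <= M) ->
  L2 f -> L2 (fun x => k x * f x).
Proof.
move=> mk kM l2f; have [mf _] := l2f.
apply: sqr_L2; first exact: measurable_funM.
apply: (@le_L1 _ (fun x => M ^+ 2 * f x ^+ 2)).
- by apply: measurable_sqr; exact: measurable_funM.
- move=> x; rewrite exprMn normrM ler_pM//; last by rewrite ger0_norm ?sqr_ge0.
  by rewrite normrX ler_sqr ?nnegrE ?kM// (le_trans _ (kM x)).
- exact/L1Z/L2_sqr.
Qed.

Lemma L2Z (k : R) f : L2 f -> L2 (fun x => k * f x).
Proof. by move=> l2f; apply: (@L2_bdd _ `|k|). Qed.

Lemma L2B f g : L2 f -> L2 g -> L2 (fun x => f x - g x).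
Proof.
move=> l2f l2g; rewrite (_ : (fun _ => _) = (fun x => f x + -1 * g x)).
  by apply: L2D => //; exact: L2Z.
by apply/funext => x; rewrite mulN1r.
Qed.

Lemma L2M f g : L2 f -> L2 g -> L1 (fun x => f x * g x).
Proof.
move=> l2f l2g; have [[mf _] [mg _]] := (l2f, l2g).
apply: (@le_L1 _ (fun x => f x ^+ 2 + g x ^+ 2)).
- exact: measurable_funM.
- move=> x; rewrite normrM -(real_normK (num_real (f x))).
  rewrite -(real_normK (num_real (g x))).
  have := sqr_ge0 (`|f x| - `|g x|); have := normr_ge0 (f x).
  by have := normr_ge0 (g x); nra.
- by apply: L1D; apply/L2_sqr.
Qed.

Lemma L1_bdd_L2 M f : (forall x, `|f x| <= M) -> L1 f -> L2 f.
Proof.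
move=> fM lf; apply: sqr_L2; first exact: L1_measurable.
by apply: (L1_bdd _ fM) => //; exact: L1_measurable.
Qed.

Lemma LfunL2 f : f \in Lfun mu 2%:E -> L2 f.
Proof.
move=> /[dup] /sub_Lfun_mfun /[!inE]/= mf /Lfun2_integrable_sqr h.
exact: sqr_L2.
Qed.

(* [L2] convergence is handled through this weighted AM-GM inequality. *)
Lemma sqrD_le (a b e : R) : 0 < e ->
  (a + b) ^+ 2 <= (1 + e) * a ^+ 2 + (1 + e^-1) * b ^+ 2.
Proof.
move=> e0; rewrite -subr_ge0.
rewrite (_ : _ - _ = (e * a - b) ^+ 2 / e); last by field; exact: lt0r_neq0.
by rewrite divr_ge0 ?sqr_ge0// ltW.
Qed.

Lemma RN2_le f g e : L2 f -> L2 g -> 0 < e ->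
  \int[mu]_x (f x ^+ 2) <= (1 + e) * \int[mu]_x (g x ^+ 2) +
    (1 + e^-1) * \int[mu]_x ((f x - g x) ^+ 2).
Proof.
move=> l2f l2g e0; have l2b := L2_sqr (L2B l2f l2g).
have [l1f l1g] := (L2_sqr l2f, L2_sqr l2g).
rewrite -!RintegralZl// -RintegralD//; [|exact: L1Z|exact: L1Z].
apply: le_Rintegral => //; first by apply: L1D; exact: L1Z.
by move=> x _; rewrite -[in leLHS](subrKC (g x) (f x)) sqrD_le.
Qed.

(** [RN2_le] is used in both directions between [g n] and [f]: the weight [e] is fixed first to make
    the excess small, then [n] is taken large against [1 + e^-1]. *)
Lemma cvg_N2 (g : nat -> T -> R) f : L2 f -> (forall n, L2 (g n)) ->
  N2 (fun x => g n x - f x) @[n --> \oo] --> 0%E ->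
  N2 (g n) @[n --> \oo] --> N2 f.
Proof.
move=> l2f l2g; rewrite (funext (fun n => N2E (L2B (l2g n) l2f))).
move=> /fine_cvgP[_ dn]; rewrite N2E// (funext (fun n => N2E (l2g n))).
apply/fine_cvgP; split; first exact: nearW.
move: dn; set D := fun n => \int[mu]_x ((g n x - f x) ^+ 2).
set G := fun n => \int[mu]_x (g n x ^+ 2); set F := \int[mu]_x (f x ^+ 2).
rewrite (_ : _ \o _ = D)// (_ : _ \o _ = G)// => dn.
have F0 : 0 <= F by apply: Rintegral_ge0 => x _; exact: sqr_ge0.
have D0 n : 0 <= D n by apply: Rintegral_ge0 => x _; exact: sqr_ge0.
have G0 n : 0 <= G n by apply: Rintegral_ge0 => x _; exact: sqr_ge0.
have le1 n e : 0 < e -> G n <= (1 + e) * F + (1 + e^-1) * D n.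
  by move=> e0; exact: RN2_le.
have le2 n e : 0 < e -> F <= (1 + e) * G n + (1 + e^-1) * D n.
  move=> e0; apply: (le_trans (RN2_le l2f (l2g n) e0)).
  rewrite lerD2l ler_wpM2l//; first by rewrite addr_ge0// invr_ge0 ltW.
  rewrite le_eqVlt; apply/predU1P; left; apply: eq_Rintegral => x _.
  by rewrite -sqrrN opprB.
apply/cvgrPdist_le => /= r r0.
(* The second argument gives [e * F <= r / 4], with [F + 1] to avoid dividing by 0. The bound
   [e <= 1] controls [e * G n], which is at most [r / 4 + r / 2] once [G n <= F + r / 2]. *)
pose e := Num.min 1 (r / (4 * (F + 1))).
have e0 : 0 < e by rewrite lt_min ltr01/= divr_gt0// mulr_gt0// ltr_pwDr.
have e1 : e <= 1 by rewrite ge_min lexx.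
have eF : e * F <= r / 4.
  apply: (@le_trans _ _ (e * (F + 1))); first by rewrite ler_wpM2l ?(ltW e0)// lerDl.
  rewrite -ler_pdivlMr ?ltr_pwDr// -mulrA -invfM ge_min; apply/orP; right; lra.
pose c := 1 + e^-1.
have c0 : 0 < c by rewrite addr_gt0// invr_gt0.
near=> n.
have Dn : D n <= r / (4 * c).
  have : `|0 - D n| <= r / (4 * c).
    by near: n; move/cvgrPdist_le : dn; apply; rewrite divr_gt0// mulr_gt0.
  by rewrite sub0r normrN ger0_norm.
have cDn : c * D n <= r / 4.
  rewrite -ler_pdivlMl// (le_trans Dn)// invfM mulrCA mulrC -mulrA.
  by rewrite mulrCA.
have := le1 n e e0; have := le2 n e e0; rewrite -/c => h2 h1.
have Gn : G n <= F + r / 2 by nra.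
rewrite ler_distl; apply/andP; split; last first.
  nra.
lra.
Unshelve. all: by end_near. Qed.

Lemma measurable_sqr_EFin f : measurable_fun [set: T] f ->
  measurable_fun [set: T] (fun x => (f x ^+ 2)%:E).
Proof. by move=> mf; exact/measurable_EFinP/measurable_sqr. Qed.

Lemma N2_le f g (C : R) : measurable_fun [set: T] f -> measurable_fun [set: T] g ->
  (forall x, `|f x| <= C * `|g x|) -> (N2 f <= (C ^+ 2)%:E * N2 g)%E.
Proof.
move=> mf mg fg; rewrite /N2 -ge0_integralZl//.
- apply: ge0_le_integral => //.
  + by move=> x _; rewrite lee_fin sqr_ge0.
  + exact: measurable_sqr_EFin.
  + by apply: emeasurable_funM => //; exact: measurable_sqr_EFin.
  + move=> x _; rewrite -EFinM lee_fin -exprMn -(real_normK (num_real (f x))).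
    rewrite -(real_normK (num_real (C * g x))) ler_sqr ?nnegrE//.
    by rewrite (le_trans (fg x))// normrM ler_wpM2r// ler_norm.
- exact: measurable_sqr_EFin.
- by move=> x _; rewrite lee_fin sqr_ge0.
- by rewrite lee_fin sqr_ge0.
Qed.

Lemma N2D_le f g : measurable_fun [set: T] f -> measurable_fun [set: T] g ->
  (N2 (fun x => f x + g x)%R <= 2%:E * N2 f + 2%:E * N2 g)%E.
Proof.
move=> mf mg; rewrite /N2 -!ge0_integralZl//; try exact: measurable_sqr_EFin;
  try by move=> x _; rewrite lee_fin sqr_ge0.
have m2 (h : T -> R) : measurable_fun [set: T] h -> measurable_fun [set: T] (fun x => 2%:E * (h x ^+ 2)%:E)%E.
  by move=> mh; apply: emeasurable_funM => //; exact: measurable_sqr_EFin.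
rewrite -ge0_integralD//; try exact: m2;
  try by move=> x _; rewrite -EFinM lee_fin mulr_ge0 ?sqr_ge0.
apply: ge0_le_integral => //.
- by move=> x _; rewrite lee_fin sqr_ge0.
- by apply: measurable_sqr_EFin; exact: measurable_funD.
- by apply: emeasurable_funD; exact: m2.
- move=> x _; rewrite -!EFinM -EFinD lee_fin.
  by have := sqr_ge0 (f x - g x); nra.
Qed.

Lemma cvg0_N2_le (f g : nat -> T -> R) (C : R) :
  (forall n, (N2 (f n) <= C%:E * N2 (g n))%E) ->
  N2 (g n) @[n --> \oo] --> 0%E -> N2 (f n) @[n --> \oo] --> 0%E.
Proof.
move=> fg g0; apply: (@squeeze_cvge _ _ _ _ (cst 0%E) _ (fun n => C%:E * N2 (g n))%E).
- by apply: nearW => n; rewrite N2_ge0 fg.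
- exact: cvg_cst.
- by rewrite -(mule0 C%:E); apply: cvgeZl.
Qed.

(** Cauchy-Schwarz is replaced by [|a b| <= e a^2 + e^-1 b^2]: the first term is made small by [e],
    the second by [n]. *)
Lemma cvg_pairing k (g : nat -> T -> R) f : L2 k -> L2 f ->
  (forall n, L2 (g n)) ->
  N2 (fun x => g n x - f x) @[n --> \oo] --> 0%E ->
  \int[mu]_x (k x * g n x) @[n --> \oo] --> \int[mu]_x (k x * f x).
Proof.
move=> l2k l2f l2g; rewrite (funext (fun n => N2E (L2B (l2g n) l2f))).
move=> /fine_cvgP[_]; rewrite [X in X @ _](_ : _ =
  (fun n => \int[mu]_x ((g n x - f x) ^+ 2)))// => dn.
set K := \int[mu]_x (k x ^+ 2).
have K0 : 0 <= K by apply: Rintegral_ge0 => x _; exact: sqr_ge0.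
apply/cvgrPdist_le => /= r r0.
pose e := r / (2 * (K + 1)).
have e0 : 0 < e by rewrite divr_gt0// mulr_gt0// ltr_pwDr.
have eK : e * K <= r / 2.
  apply: (@le_trans _ _ (e * (K + 1))); first by rewrite ler_wpM2l ?(ltW e0)// lerDl.
  rewrite le_eqVlt; apply/predU1P; left; rewrite /e; field.
  by rewrite gt_eqF// ltr_pwDr.
near=> n.
have l2d := L2B (l2g n) l2f; have l1kd := L2M l2k l2d.
rewrite distrC -RintegralB//; [|exact: L2M|exact: L2M].
under eq_Rintegral do rewrite -mulrBr.
apply: (le_trans (le_normr_Rintegral _ l1kd)) => //.
apply: (@le_trans _ _ (\int[mu]_x (e * k x ^+ 2 + e^-1 * (g n x - f x) ^+ 2))).
  apply: le_Rintegral => //.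
  - exact: L1_norm.
  - by apply: L1D; apply: L1Z; exact: L2_sqr.
  - move=> x _; rewrite normrM; set b := _ - _.
    rewrite -(real_normK (num_real (k x))) -(real_normK (num_real b)).
    rewrite -subr_ge0 (_ : _ - _ = ((e * `|k x| - `|b|) ^+ 2 + e * `|k x| * `|b|) / e).
      apply: divr_ge0 (ltW e0); apply: addr_ge0; first exact: sqr_ge0.
      by rewrite mulr_ge0// mulr_ge0// ltW.
    by field; exact: lt0r_neq0.
rewrite RintegralD//; [|exact/L1Z/L2_sqr|exact/L1Z/L2_sqr].
rewrite !RintegralZl//; [|exact: L2_sqr|exact: L2_sqr].
rewrite [leRHS]splitr lerD// ler_pdivrMl//.
have : `|0 - \int[mu]_x ((g n x - f x) ^+ 2)| <= e * (r / 2).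
  by near: n; move/cvgrPdist_le : dn; apply; rewrite mulr_gt0// divr_gt0.
by rewrite sub0r normrN; apply: le_trans; exact: ler_norm.
Unshelve. all: by end_near. Qed.

Lemma cvg_Rintegral (f_ : nat -> T -> R) f g :
  (forall n, measurable_fun [set: T] (f_ n)) -> measurable_fun [set: T] f ->
  (forall x, f_ n x @[n --> \oo] --> f x) -> L1 g ->
  (forall n x, `|f_ n x| <= g x) ->
  \int[mu]_x f_ n x @[n --> \oo] --> \int[mu]_x f x.
Proof.
move=> mf_ mf cf lg fg.
have [] := @dominated_convergence _ _ _ mu setT measurableT
  (fun n x => (f_ n x)%:E) (EFin \o f) (EFin \o g).
- by move=> n; exact/measurable_EFinP.
- exact/measurable_EFinP.
- by apply: aeW => x _; apply: cvg_EFin; [exact: nearW|exact: cf].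
- exact: lg.
- by apply: aeW => x n _; rewrite /= lee_fin.
move=> lf _ h; apply: fine_cvg; rewrite fineK//.
by apply: integrable_fin_num => //; exact: lf.
Qed.

End L2_functions.

(** * Change of variables under translations and reflection *)

Section measure_preserving.
Context d (T : measurableType d) (R : realType) (mu : {measure set T -> \bar R}).
Variable phi : T -> T.
Hypothesis mphi : measurable_fun [set: T] phi.
Hypothesis mu_phi : forall A, measurable A -> mu (phi @^-1` A) = mu A.

Lemma ge0_integral_preserving (f : T -> \bar R) : measurable_fun [set: T] f ->
  (forall x, 0 <= f x)%E -> (\int[mu]_x f (phi x) = \int[mu]_x f x)%E.
Proof.
move=> mf f0; have := ge0_integral_pushforward mphi mu measurableT mf.
rewrite preimage_setT => /(_ (fun x _ => f0 x)) <-.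
by apply: eq_measure_integral => A mA _; exact: mu_phi.
Qed.

Lemma integral_preserving (f : T -> \bar R) : measurable_fun [set: T] f ->
  (\int[mu]_x f (phi x) = \int[mu]_x f x)%E.
Proof.
move=> mf; rewrite [LHS]integralE [RHS]integralE.
rewrite -(ge0_integral_preserving (measurable_funepos mf))//.
rewrite -(ge0_integral_preserving (measurable_funeneg mf))//.
by have := funepos_comp f phi; have := funeneg_comp f phi; rewrite /comp => -> ->.
Qed.

Lemma Rintegral_preserving (f : T -> R) : measurable_fun [set: T] f ->
  \int[mu]_x f (phi x) = \int[mu]_x f x.
Proof.
by move=> mf; rewrite /Rintegral -(@integral_preserving (EFin \o f))//;
  exact/measurable_EFinP.
Qed.

Lemma L1_preserving (f : T -> R) : L1 mu f -> L1 mu (fun x => f (phi x)).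
Proof.
move=> /[dup] /L1_measurable mf /integrableP[_ h]; apply/integrableP; split.
  by apply/measurable_EFinP; exact: measurableT_comp.
rewrite (@ge0_integral_preserving (fun x => `|(f x)%:E|%E))//.
by apply/measurable_EFinP; exact: measurableT_comp.
Qed.

Lemma N2_preserving (f : T -> R) : measurable_fun [set: T] f ->
  N2 mu (fun x => f (phi x)) = N2 mu f.
Proof.
move=> mf; rewrite /N2 (@ge0_integral_preserving (fun x => (f x ^+ 2)%:E))//.
- exact/measurable_EFinP/measurable_sqr.
- by move=> x; rewrite lee_fin sqr_ge0.
Qed.

Lemma L2_preserving (f : T -> R) : L2 mu f -> L2 mu (fun x => f (phi x)).
Proof.
by case=> mf h; split; [exact: measurableT_comp|rewrite N2_preserving].
Qed.

End measure_preserving.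

Section lebesgue_preserving.
Context (R : realType).
Notation mu := (@lebesgue_measure R).

Lemma lebesgue_measure_preimageN (A : set (measurableTypeR R)) : measurable A ->
  mu ((-%R : measurableTypeR R -> measurableTypeR R) @^-1` A) = mu A.
Proof. exact: lebesgue_measureN. Qed.

(** The pushforward under the shift agrees with Lebesgue measure on half-open intervals, and these
    determine it. *)
Lemma lebesgue_measure_shift (a : R) (A : set (measurableTypeR R)) :
  measurable A ->
  mu ((fun x : measurableTypeR R => x + a : measurableTypeR R) @^-1` A) = mu A.
Proof.
pose s := (fun x : measurableTypeR R => x + a : measurableTypeR R).
have ms : measurable_fun [set: measurableTypeR R] s by exact: measurable_funD.
pose nu := pushforward mu s.
move=> mA; apply/esym; apply: (@lebesgue_measure_unique R nu) => //.
move=> _ [[b c]] _ <-.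
have E : s @^-1` `]b, c]%classic = `]b - a, c - a]%classic.
  by apply/seteqP; split=> x/=; rewrite !in_itv/= ltrBlDr lerBrDr.
transitivity (mu `]b - a, c - a]%classic); last by congr (mu _); rewrite -E.
rewrite !lebesgue_measure_itv/= !lte_fin ltrD2r -!EFinB.
by rewrite (_ : c - a - (b - a) = c - b)//; ring.
Qed.

End lebesgue_preserving.

(** * Explicit integrals: damped cosine and Cauchy density *)

Section exponential_integrals.
Context (R : realType).
Notation mu := (@lebesgue_measure R).

(** The derivative rules produce scalings in [R^o]; they must become products before [ring] or
    [field] can close the goal. *)
Lemma scaleR_mul (a b : R) : a *: (b : R^o) = a * b. Proof. by []. Qed.

Lemma cvg_expRN_bounded (c M : R) (b : R -> R) : 0 < c -> (forall t, `|b t| <= M) ->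
  expR (- (c * t)) * b t @[t --> +oo] --> 0.
Proof.
move=> c0 bM.
have h : M * expR (- (c * t)) @[t --> +oo] --> 0.
  rewrite -[X in _ --> X](mulr0 M); apply: cvgMr.
  apply: (@cvg_comp _ _ _ (fun t => c * t) (fun t => expR (- t)) _ (+oo)).
    exact: gt0_cvgMry.
  exact: cvgr_expR.
apply/cvgr0Pnorm_le => e e0; near=> t.
apply: (@le_trans _ _ (M * expR (- (c * t)))).
  by rewrite normrM (ger0_norm (expR_ge0 _)) mulrC ler_wpM2r ?expR_ge0.
apply: le_trans (ler_norm _) _.
by near: t; move/cvgr0Pnorm_le : h; exact.
Unshelve. all: by end_near. Qed.

(** Adding 1 to the cosine makes the integrand nonnegative, as the fundamental theorem on a
    half-line used here requires. The cosine integral is recovered later by subtracting what the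
    case [w = 0] gives. *)
Lemma integral_expR_1cos (c w : R) : 0 < c ->
  (\int[mu]_(t in `[0%R, +oo[) (expR (- (c * t)) * (1 + cos (w * t)))%:E =
   (c^-1 + c / (c ^+ 2 + w ^+ 2))%:E)%E.
Proof.
move=> c0; pose q := c ^+ 2 + w ^+ 2.
have q0 : q != 0 by rewrite gt_eqF// ltr_pwDl ?sqr_ge0// exprn_gt0.
have cn0 : c != 0 by rewrite gt_eqF.
(* [expR (- (c * t)) * b t] is the antiderivative: the constant [- c^-1] accounts for the summand 1,
   the rest for the cosine. *)
pose b t := - c^-1 + q^-1 * (w * sin (w * t) - c * cos (w * t)).
pose F t := expR (- (c * t)) * b t.
have dF (t : R) : is_derive t 1 F (expR (- (c * t)) * (1 + cos (w * t))).
  rewrite /F /b; apply: is_derive_eq.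
  rewrite !scaleR_mul /q; field.
  by rewrite q0 cn0.
have cF : continuous F.
  by move=> t; apply/differentiable_continuous/derivable1_diffP; have [] := dF t.
rewrite (@ge0_continuous_FTC2y _ _ F _ 0).
- rewrite sub0e /F /b !mulr0 oppr0 expR0 sin0 cos0 -EFinN; congr EFin.
  by rewrite /q; field; rewrite cn0 q0.
- by move=> x _; rewrite mulr_ge0 ?expR_ge0//; have := cos_geN1 (w * x); lra.
- apply: continuous_subspaceT => x; apply: cvgM.
    by apply: continuous_comp; [apply: cvgN; exact: cvgMr|exact: continuous_expR].
  apply: cvgD; first exact: cvg_cst.
  by apply: continuous_comp; [exact: cvgMr|exact: continuous_cos].
- apply: (@cvg_expRN_bounded c (`|c^-1| + `|q^-1| * (`|w| + `|c|))) => // t.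
  rewrite (le_trans (ler_normD _ _))// normrN lerD2l normrM ler_wpM2l//.
  rewrite (le_trans (ler_normB _ _))// !normrM lerD// ler_piMr//.
    by rewrite ler_norml sin_geN1 sin_le1.
  by rewrite ler_norml cos_geN1 cos_le1.
- by move=> x _; have [] := dF x.
- by apply: cvg_at_right_filter; exact: cF.
- by move=> x _; rewrite derive1E; apply: derive_val.
Qed.

Lemma set_ge0_itv : [set x : R | 0 <= x] = `[0, +oo[%classic.
Proof. by apply/seteqP; split=> x/=; rewrite in_itv/= andbT. Qed.

Lemma integral_expR_abs_1cos (c w : R) : 0 < c ->
  (\int[mu]_t (expR (- (c * `|t|)) * (1 + cos (w * t)))%:E =
   (2 * (c^-1 + c / (c ^+ 2 + w ^+ 2)))%:E)%E.
Proof.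
move=> c0; rewrite ge0_symfun_integralT.
- rewrite set_ge0_itv EFinM -(integral_expR_1cos w c0); congr (_ * _)%E.
  by apply: eq_integral => t; rewrite inE/= in_itv/= andbT => t0; rewrite ger0_norm.
- by move=> x; rewrite mulr_ge0 ?expR_ge0//; have := cos_geN1 (w * x); lra.
- move=> x; apply: cvgM.
    apply: continuous_comp; last exact: continuous_expR.
    by apply: cvgN; apply: cvgMr; exact: norm_continuous.
  apply: cvgD; first exact: cvg_cst.
  by apply: continuous_comp; [exact: cvgMr|exact: continuous_cos].
- by move=> x /=; rewrite normrN mulrN cosN.
Qed.

Lemma continuous_expR_abs (c : R) : continuous (fun t : R => expR (- (c * `|t|))).
Proof.
move=> x; apply: continuous_comp; last exact: continuous_expR.
by apply: cvgN; apply: cvgMr; exact: norm_continuous.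
Qed.

Lemma measurable_expR_abs (c : R) :
  measurable_fun [set: R] (fun t : R => expR (- (c * `|t|))).
Proof. by apply: continuous_measurable_fun; exact: continuous_expR_abs. Qed.

Lemma measurable_cosM (w : R) : measurable_fun [set: R] (fun t : R => cos (w * t)).
Proof.
apply: continuous_measurable_fun => x.
by apply: continuous_comp; [exact: cvgMr|exact: continuous_cos].
Qed.

Lemma measurable_sinM (w : R) : measurable_fun [set: R] (fun t : R => sin (w * t)).
Proof.
apply: continuous_measurable_fun => x.
by apply: continuous_comp; [exact: cvgMr|exact: continuous_sin].
Qed.

Lemma L1_expR_abs (c : R) : 0 < c -> L1 mu (fun t : R => expR (- (c * `|t|))).
Proof.
move=> c0; apply/integrableP; split; first by apply/measurable_EFinP; exact: measurable_expR_abs.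
apply: (@le_lt_trans _ _
  (\int[mu]_t (expR (- (c * `|t|)) * (1 + cos (0 * t)))%:E)%E).
  apply: ge0_le_integral => //.
  - by apply/measurable_EFinP; apply: measurableT_comp => //; exact: measurable_expR_abs.
  - apply/measurable_EFinP; apply: measurable_funM; first exact: measurable_expR_abs.
    by apply: measurable_funD => //; exact: measurable_cosM.
  - move=> t _ /=; rewrite mul0r cos0 lee_fin ger0_norm ?expR_ge0//.
    by rewrite ler_peMr ?expR_ge0//; lra.
by rewrite integral_expR_abs_1cos// ltry.
Qed.

Lemma Rintegral_expR_abs_cos (c w : R) : 0 < c ->
  \int[mu]_t (expR (- (c * `|t|)) * cos (w * t)) = 2 * c / (c ^+ 2 + w ^+ 2).
Proof.
move=> c0.
have cn0 : c != 0 by rewrite gt_eqF.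
have q0 : c ^+ 2 + w ^+ 2 != 0 by rewrite gt_eqF// ltr_pwDl ?sqr_ge0// exprn_gt0.
have e1 := L1_expR_abs c0.
have h v : \int[mu]_t (expR (- (c * `|t|)) * (1 + cos (v * t))) =
    2 * (c^-1 + c / (c ^+ 2 + v ^+ 2)).
  by rewrite /Rintegral integral_expR_abs_1cos.
have h0 : \int[mu]_t (expR (- (c * `|t|))) = 2 / c.
  have := h 0; under eq_Rintegral do rewrite mul0r cos0 mulrC.
  rewrite RintegralZl// => h0; apply: (@mulfI _ 2); first by rewrite pnatr_eq0.
  rewrite (_ : 2 = 1 + 1)//= in h0 *; rewrite h0.
  by field.
have mc : L1 mu (fun t : R => expR (- (c * `|t|)) * cos (w * t)).
  rewrite (_ : (fun _ => _) = (fun t : R => cos (w * t) * expR (- (c * `|t|)))); last first.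
    by apply/funext => t; rewrite mulrC.
  apply: (@L1_bdd _ _ _ _ _ 1) => //.
    exact: measurable_cosM.
  by move=> x; rewrite ler_norml cos_geN1 cos_le1.
have := h w; under eq_Rintegral do rewrite mulrDr mulr1.
rewrite RintegralD// h0 => /(canRL (addKr _)) ->.
by field; rewrite cn0 q0.
Qed.

Lemma Rintegral_odd (f : R -> R) : L1 mu f ->
  (forall x, f (- x) = - f x) -> \int[mu]_x f x = 0.
Proof.
move=> lf fN.
have h : \int[mu]_x f (- x) = \int[mu]_x f x.
  apply: Rintegral_preserving => //; first exact: lebesgue_measure_preimageN.
  exact: L1_measurable lf.
have : \int[mu]_x (-1 * f x) = \int[mu]_x f x.
  by rewrite -h; apply: eq_Rintegral => x _; rewrite fN mulN1r.
by rewrite RintegralZl//; lra.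
Qed.

Lemma integral_inv_sqrD (y : R) : 0 < y ->
  (\int[mu]_x (y / (y ^+ 2 + x ^+ 2))%:E = pi%:E)%E.
Proof.
move=> y0; have yn0 : y != 0 by rewrite gt_eqF.
have q0 (x : R) : y ^+ 2 + x ^+ 2 != 0.
  by rewrite gt_eqF// ltr_pwDl ?sqr_ge0// exprn_gt0.
have cf : continuous (fun x : R => y / (y ^+ 2 + x ^+ 2)).
  move=> x; apply: cvgM; first exact: cvg_cst.
  apply: cvgV; first exact: q0.
  by apply: cvgD; [exact: cvg_cst|exact: exprn_continuous].
pose F (x : R) := atan (y^-1 * x).
have dF (x : R) : is_derive x 1 F (y / (y ^+ 2 + x ^+ 2)).
  rewrite /F; apply: is_derive_eq.
  by rewrite !scaleR_mul; field; rewrite yn0 q0.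
have cF : continuous F.
  by move=> t; apply/differentiable_continuous/derivable1_diffP; have [] := dF t.
rewrite ge0_symfun_integralT//.
- rewrite set_ge0_itv (@ge0_continuous_FTC2y _ _ F _ (pi / 2)).
  + by rewrite /F mulr0 atan0 sube0 -EFinM mulrC divfK.
  + by move=> x _; rewrite divr_ge0 ?(ltW y0)// addr_ge0 ?sqr_ge0.
  + exact: continuous_subspaceT.
  + apply: (@cvg_comp _ _ _ (fun t => y^-1 * t) atan _ (+oo)); last exact: cvgy_atan.
    by apply: gt0_cvgMry; rewrite ?invr_gt0.
  + by move=> x _; have [] := dF x.
  + by apply: cvg_at_right_filter; exact: cF.
  + by move=> x _; rewrite derive1E; apply: derive_val.
- by move=> x; rewrite divr_ge0 ?(ltW y0)// addr_ge0 ?sqr_ge0.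
- by move=> x /=; rewrite sqrrN.
Qed.

End exponential_integrals.

(** * Fubini for real-valued kernels on the plane *)

Section real_fubini.
Context (R : realType).
Notation mu := (@lebesgue_measure R).

Section swap.
Variable k : R -> R -> R.
Hypothesis mk : measurable_fun [set: measurableTypeR R * measurableTypeR R]
  (fun z => k z.1 z.2).
Hypothesis kx : forall x, L1 mu (k x).
Hypothesis ky : forall y, L1 mu (fun x => k x y).

Let mkE : measurable_fun [set: measurableTypeR R * measurableTypeR R]
  (fun z => (k z.1 z.2)%:E).
Proof. exact/measurable_EFinP. Qed.

Section integrable_on_product.
Hypothesis ik : (mu \x mu)%E.-integrable setT (fun z => (k z.1 z.2)%:E).

Let integral_kx x : (\int[mu]_y (k x y)%:E = (\int[mu]_y k x y)%:E)%E.
Proof. by rewrite /Rintegral fineK//; exact: integrable_fin_num (kx x). Qed.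

Let integral_ky y : (\int[mu]_x (k x y)%:E = (\int[mu]_x k x y)%:E)%E.
Proof. by rewrite /Rintegral fineK//; exact: integrable_fin_num (ky y). Qed.

Lemma L1_Rintegral : L1 mu (fun x => \int[mu]_y k x y).
Proof.
have := integrable_fubini_F ik; rewrite /fubini_F/=.
by under eq_fun do rewrite integral_kx.
Qed.

Lemma Rintegral_swap :
  \int[mu]_x (\int[mu]_y k x y) = \int[mu]_y (\int[mu]_x k x y).
Proof.
rewrite [LHS]/Rintegral [RHS]/Rintegral.
under eq_integral do rewrite -integral_kx.
under [in RHS]eq_integral do rewrite -integral_ky.
by rewrite (Fubini ik).
Qed.

End integrable_on_product.

(** This form serves the autocorrelation kernel [f x * P_y h * f (x + h)], which need not be
    dominated by a product of integrable functions of one variable; the transform kernels are, and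
    use [L1_integrable_prodM]. *)
Lemma L1_integrable_prod (B : R -> R) :
  (forall y, \int[mu]_x `|k x y| <= B y) -> L1 mu B ->
  (mu \x mu)%E.-integrable setT (fun z => (k z.1 z.2)%:E).
Proof.
move=> kB lB; apply/(integrable21ltyP _ _ mkE).
have [mB fB] := integrableP _ _ _ lB.
apply: le_lt_trans fB; apply: ge0_le_integral => //.
- by move=> y _; exact: integral_ge0.
- have mabs : measurable_fun setT (fun z : measurableTypeR R * measurableTypeR R =>
      `|(k z.1 z.2)%:E|%E) by exact: measurableT_comp.
  exact: (@measurable_fun_fubini_tonelli_G _ _ _ _ _ mu _ mabs (fun=> abse_ge0 _)).
- exact: measurableT_comp.
- move=> y _ /=; rewrite (_ : (\int[mu]_x _)%E = (\int[mu]_x `|k x y|)%:E).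
    by rewrite lee_fin (le_trans (kB y))// ler_norm.
  by rewrite /Rintegral fineK//; apply: integrable_fin_num (L1_norm (ky y)).
Qed.

Lemma L1_Rintegral2 (B : R -> R) :
  (forall y, \int[mu]_x `|k x y| <= B y) -> L1 mu B ->
  L1 mu (fun y => \int[mu]_x k x y).
Proof.
move=> kB lB; apply: (le_L1 _ _ lB); last first.
  by move=> y; exact: le_trans (le_normr_Rintegral measurableT (ky y)) (kB y).
have := measurable_fubini_G (L1_integrable_prod kB lB); rewrite /fubini_G/=.
rewrite (_ : (fun y => _) = (fun y => (\int[mu]_x k x y)%:E)).
  by move/measurable_EFinP.
by apply/funext => y; rewrite /Rintegral fineK//; exact: integrable_fin_num (ky y).
Qed.

Lemma L1_integrable_prodM (a b : R -> R) :
  (forall x y, `|k x y| <= a x * b y) -> L1 mu a -> L1 mu b ->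
  (mu \x mu)%E.-integrable setT (fun z => (k z.1 z.2)%:E).
Proof.
move=> kab la lb; apply: (@L1_integrable_prod (fun y => (\int[mu]_x a x) * b y)).
  move=> y; rewrite mulrC -RintegralZl//; apply: le_Rintegral => //.
  - exact: L1_norm.
  - exact: L1Z.
  - by move=> x _; rewrite mulrC.
exact: L1Z.
Qed.

End swap.
End real_fubini.

(** * The Hartley transform on L1 and its damped inversion *)

Section hartley.
Context (R : realType).
Notation mu := (@lebesgue_measure R).
Implicit Types (f : R -> R) (x y s t v w h d e L M : R).

Lemma L1_shift (a : R) f : L1 mu f -> L1 mu (fun x : R => f (x + a)).
Proof. by move/(L1_preserving _ (lebesgue_measure_shift a)); apply; exact: measurable_funD. Qed.

Lemma L2_shift (a : R) f : L2 mu f -> L2 mu (fun x : R => f (x + a)).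
Proof. by move/(L2_preserving _ (lebesgue_measure_shift a)); apply; exact: measurable_funD. Qed.

Lemma L2_opp f : L2 mu f -> L2 mu (fun x : R => f (- x)).
Proof. by move/(L2_preserving _ (@lebesgue_measure_preimageN R)); exact. Qed.

Lemma Rintegral_shift (a : R) f : measurable_fun [set: R] f ->
  \int[mu]_x f (x + a) = \int[mu]_x f x.
Proof.
apply: (Rintegral_preserving _ (lebesgue_measure_shift a)).
exact: measurable_funD.
Qed.

Lemma Rintegral_opp f : measurable_fun [set: R] f ->
  \int[mu]_x f (- x) = \int[mu]_x f x.
Proof. exact: (Rintegral_preserving _ (@lebesgue_measure_preimageN R)). Qed.

Definition cas (a : R) := cos a + sin a.

Definition hartley f (t : R) := \int[mu]_x (cas (2 * pi * x * t) * f x).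

(** The multiplier of the Poisson semigroup: its Hartley transform is [poisson_kernel y]. *)
Definition damp (y t : R) := expR (- (2 * pi * y * `|t|)).

Definition poisson_kernel (y x : R) := pi^-1 * (y / (y ^+ 2 + x ^+ 2)).

Lemma cas_le2 (a : R) : `|cas a| <= 2.
Proof.
rewrite /cas (le_trans (ler_normD _ _))// (_ : 2 = 1 + 1)// lerD// ler_norml.
  by rewrite cos_geN1 cos_le1.
by rewrite sin_geN1 sin_le1.
Qed.

Lemma casM (a b : R) : cas a * cas b = cos (a - b) + sin (a + b).
Proof. by rewrite /cas cosB sinD; ring. Qed.

Lemma continuous_cas : continuous cas.
Proof. by move=> x; apply: cvgD; [exact: continuous_cos|exact: continuous_sin]. Qed.

Lemma measurable_cas : measurable_fun [set: R] cas.
Proof. exact: continuous_measurable_fun continuous_cas. Qed.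

Lemma measurable_casl (t : R) : measurable_fun [set: R] (fun x : R => cas (2 * pi * x * t)).
Proof.
apply: (measurableT_comp measurable_cas).
by apply: measurable_funM => //; exact: measurable_funM.
Qed.

Lemma measurable_casr (x : R) : measurable_fun [set: R] (fun t : R => cas (2 * pi * x * t)).
Proof. by apply: (measurableT_comp measurable_cas); exact: measurable_funM. Qed.

Lemma measurable_cas2 : measurable_fun [set: measurableTypeR R * measurableTypeR R]
  (fun z => cas (2 * pi * z.2 * z.1)).
Proof.
apply: (measurableT_comp measurable_cas).
by apply: measurable_funM => //; exact: measurable_funM.
Qed.

Lemma L1_cas f t : L1 mu f -> L1 mu (fun x => cas (2 * pi * x * t) * f x).
Proof. by apply: L1_bdd; [exact: measurable_casl|move=> x; exact: cas_le2]. Qed.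

Lemma hartley_le f t : L1 mu f -> `|hartley f t| <= 2 * \int[mu]_x `|f x|.
Proof.
move=> lf; apply: (le_trans (le_normr_Rintegral _ (L1_cas t lf))) => //.
rewrite -RintegralZl//; last exact: L1_norm.
apply: le_Rintegral => //.
- exact/L1_norm/L1_cas.
- exact/L1Z/L1_norm.
- by move=> x _; rewrite normrM ler_wpM2r// cas_le2.
Qed.

Lemma damp_ge0 y t : 0 <= damp y t. Proof. exact: expR_ge0. Qed.

Lemma L1_damp y : 0 < y -> L1 mu (damp y).
Proof. by move=> y0; apply: L1_expR_abs; rewrite !mulr_gt0// pi_gt0. Qed.

Lemma measurable_damp y : measurable_fun [set: R] (damp y).
Proof. exact: measurable_expR_abs. Qed.

Lemma damp_le1 y t : 0 < y -> damp y t <= 1.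
Proof.
by move=> y0; rewrite -expR0 ler_expR oppr_le0 !mulr_ge0 ?pi_ge0// ltW.
Qed.

Lemma L1_damp_bdd y (b : R -> R) M : 0 < y -> measurable_fun [set: R] b ->
  (forall t, `|b t| <= M) -> L1 mu (fun t => damp y t * b t).
Proof.
move=> y0 mb bM; rewrite (_ : (fun _ => _) = (fun t => b t * damp y t)).
  exact: L1_bdd (L1_damp y0).
by apply/funext => t; rewrite mulrC.
Qed.

(** The kernel of [hartley f] alone is not integrable in [t]. Multiplied by [damp 1] it is
    integrable on the plane, Fubini yields measurability, and the factor is then divided out because
    it never vanishes. *)
Lemma measurable_hartley f : L1 mu f -> measurable_fun [set: R] (hartley f).
Proof.
move=> lf; have mf := L1_measurable lf.
pose k (t x : R) := damp 1 t * (cas (2 * pi * x * t) * f x).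
have mk : measurable_fun [set: measurableTypeR R * measurableTypeR R]
    (fun z => k z.1 z.2).
  apply: measurable_funM; first exact: (measurableT_comp (measurable_damp 1)).
  by apply: measurable_funM; [exact: measurable_cas2|exact: (measurableT_comp mf)].
have kt t : L1 mu (k t) by apply: L1Z; exact: L1_cas.
have kx x : L1 mu (fun t => k t x).
  apply: (@L1_damp_bdd 1 (fun t => cas (2 * pi * x * t) * f x) (2 * `|f x|)) => //.
    by apply: measurable_funM => //; exact: measurable_casr.
  by move=> t; rewrite normrM ler_wpM2r ?cas_le2.
have ik : (mu \x mu)%E.-integrable setT (fun z => (k z.1 z.2)%:E).
  apply: (L1_integrable_prodM mk kx (a := damp 1) (b := fun x => 2 * `|f x|)).
  - move=> t x; rewrite /k normrM (ger0_norm (damp_ge0 _ _)) ler_wpM2l ?damp_ge0//.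
    by rewrite normrM ler_wpM2r ?cas_le2.
  - exact: L1_damp.
  - exact/L1Z/L1_norm.
have /L1_measurable := L1_Rintegral kt ik.
move=> h0; have h : measurable_fun [set: R] (fun t => damp 1 t * hartley f t).
  rewrite (_ : (fun _ => _) = fun t => \int[mu]_x k t x)//.
  by apply/funext => t; rewrite /k RintegralZl//; exact: L1_cas.
 rewrite (_ : hartley f = fun t => expR (2 * pi * 1 * `|t|) * (damp 1 t * hartley f t)).
  apply: measurable_funM => //; have := measurable_expR_abs (- (2 * pi * 1) : R).
  by under eq_fun do rewrite mulNr opprK.
by apply/funext => t; rewrite mulrA /damp -expRD subrr expR0 mul1r.
Qed.

Lemma poisson_kernel_ge0 y x : 0 < y -> 0 <= poisson_kernel y x.
Proof.
move=> y0; rewrite mulr_ge0 ?invr_ge0 ?pi_ge0// divr_ge0 ?(ltW y0)//.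
by rewrite addr_ge0 ?sqr_ge0.
Qed.

Lemma poisson_kernelN y x : poisson_kernel y (- x) = poisson_kernel y x.
Proof. by rewrite /poisson_kernel sqrrN. Qed.

Lemma measurable_poisson_kernel y : 0 < y -> measurable_fun [set: R] (poisson_kernel y).
Proof.
move=> y0; apply: continuous_measurable_fun => x.
apply: cvgM; first exact: cvg_cst.
apply: cvgM; first exact: cvg_cst.
apply: cvgV; first by rewrite gt_eqF// ltr_pwDl ?sqr_ge0// exprn_gt0.
by apply: cvgD; [exact: cvg_cst|exact: exprn_continuous].
Qed.

Lemma poisson_kernel_le y x : 0 < y -> `|poisson_kernel y x| <= pi^-1 * y^-1.
Proof.
move=> y0; rewrite ger0_norm ?poisson_kernel_ge0// ler_wpM2l ?invr_ge0 ?pi_ge0//.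
rewrite ler_pdivrMr ?ltr_pwDl ?sqr_ge0 ?exprn_gt0//.
by rewrite mulrDr expr2 mulKf ?gt_eqF// lerDl mulr_ge0 ?sqr_ge0// invr_ge0 ltW.
Qed.

Lemma integral_poisson_kernel y : 0 < y -> (\int[mu]_x (poisson_kernel y x)%:E = 1)%E.
Proof.
move=> y0; under eq_integral do rewrite EFinM.
rewrite ge0_integralZl//.
- by rewrite integral_inv_sqrD// -EFinM mulVf// gt_eqF// pi_gt0.
- apply/measurable_EFinP; have := measurable_poisson_kernel y0 => h.
  rewrite (_ : (fun _ => _) = (fun x => pi * poisson_kernel y x)); first exact: measurable_funM.
  by apply/funext => x; rewrite /poisson_kernel mulVKf// gt_eqF// pi_gt0.
- by move=> x _; rewrite lee_fin divr_ge0 ?(ltW y0)// addr_ge0 ?sqr_ge0.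
- by rewrite lee_fin invr_ge0 pi_ge0.
Qed.

Lemma L1_poisson_kernel y : 0 < y -> L1 mu (poisson_kernel y).
Proof.
move=> y0; apply/integrableP; split; first by apply/measurable_EFinP; exact: measurable_poisson_kernel.
under eq_integral do rewrite gee0_abs ?lee_fin ?poisson_kernel_ge0//.
by rewrite integral_poisson_kernel// ltry.
Qed.

Lemma Rintegral_poisson_kernel y : 0 < y -> \int[mu]_x poisson_kernel y x = 1.
Proof. by move=> y0; rewrite /Rintegral integral_poisson_kernel. Qed.

Lemma L1_poisson_kernelM y f a : 0 < y -> L1 mu f -> L1 mu (fun s : R => poisson_kernel y (a - s) * f s).
Proof.
move=> y0; apply: L1_bdd => [|s]; last exact: poisson_kernel_le.
apply: (measurableT_comp (measurable_poisson_kernel y0)).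
exact: measurable_funB.
Qed.

(** By [casM] the product is a cosine of the difference plus a sine of the sum. The sine term is odd
    in [t] and integrates to 0 against the even factor [damp], so only a function of [x - s]
    remains. *)
Lemma Rintegral_damp_cas y x s : 0 < y ->
  \int[mu]_t (damp y t * (cas (2 * pi * x * t) * cas (2 * pi * s * t))) = poisson_kernel y (x - s).
Proof.
move=> y0; have c0 : 0 < 2 * pi * y by rewrite !mulr_gt0// pi_gt0.
pose g (t : R) := damp y t * sin (2 * pi * (x + s) * t).
pose h (t : R) := damp y t * cos (2 * pi * (x - s) * t).
have lg : L1 mu g.
  apply: (@L1_damp_bdd _ _ 1) => //; first exact: measurable_sinM.
  by move=> t; rewrite ler_norml sin_geN1 sin_le1.
have lh : L1 mu h.
  apply: (@L1_damp_bdd _ _ 1) => //; first exact: measurable_cosM.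
  by move=> t; rewrite ler_norml cos_geN1 cos_le1.
transitivity (\int[mu]_t (h t + g t)).
  apply: eq_Rintegral => t _; rewrite casM /h /g -mulrDr; congr (_ * _).
  by congr (cos _ + sin _); ring.
rewrite RintegralD// (Rintegral_odd lg) ?addr0; last first.
  by move=> t; rewrite /g /damp normrN mulrN sinN mulrN.
rewrite /h /damp Rintegral_expR_abs_cos// /poisson_kernel.
have q0 : y ^+ 2 + (x - s) ^+ 2 != 0 by rewrite gt_eqF// ltr_pwDl ?sqr_ge0// exprn_gt0.
have p0 : pi != 0 :> R by rewrite gt_eqF// pi_gt0.
move: (pi) p0 => p p0.
have -> : (2 * p * y) ^+ 2 + (2 * p * (x - s)) ^+ 2 = (2 * p) ^+ 2 * (y ^+ 2 + (x - s) ^+ 2).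
  by ring.
by field; rewrite q0 p0.
Qed.

(** Abel summation of the inversion formula: exchanging the two integrals leaves
    [Rintegral_damp_cas] inside. *)
Lemma damp_cas_hartley f y x : 0 < y -> L1 mu f ->
  \int[mu]_t (damp y t * cas (2 * pi * x * t) * hartley f t) =
  \int[mu]_s (poisson_kernel y (x - s) * f s).
Proof.
move=> y0 lf; have mf := L1_measurable lf.
pose k (t s : R) := damp y t * cas (2 * pi * x * t) * (cas (2 * pi * s * t) * f s).
have mk : measurable_fun [set: measurableTypeR R * measurableTypeR R]
    (fun z => k z.1 z.2).
  apply: measurable_funM.
    apply: measurable_funM; first exact: (measurableT_comp (measurable_damp y)).
    exact: (measurableT_comp (measurable_casr x)).
  by apply: measurable_funM; [exact: measurable_cas2|exact: (measurableT_comp mf)].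
have kt t : L1 mu (k t) by apply: L1Z; exact: L1_cas.
have kE s t : k t s = f s * (damp y t * (cas (2 * pi * x * t) * cas (2 * pi * s * t))).
  by rewrite /k; ring.
have lcc s : L1 mu (fun t => damp y t * (cas (2 * pi * x * t) * cas (2 * pi * s * t))).
  apply: (@L1_damp_bdd _ _ (2 * 2)) => //.
    by apply: measurable_funM; exact: measurable_casr.
  by move=> t; rewrite normrM ler_pM// cas_le2.
have ks s : L1 mu (fun t => k t s).
  by rewrite (funext (kE s)); exact: L1Z.
have ik : (mu \x mu)%E.-integrable setT (fun z => (k z.1 z.2)%:E).
  apply: (L1_integrable_prodM mk ks (a := damp y) (b := fun x => 4 * `|f x|)).
  - move=> t s; rewrite kE normrM mulrC normrM (ger0_norm (damp_ge0 _ _)) -[leLHS]mulrA.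
    rewrite ler_wpM2l ?damp_ge0// (_ : 4 = 2 * 2); last by ring.
    by rewrite ler_wpM2r// normrM ler_pM// cas_le2.
  - exact: L1_damp.
  - exact/L1Z/L1_norm.
transitivity (\int[mu]_t \int[mu]_s k t s).
  by apply: eq_Rintegral => t _; rewrite /k RintegralZl//; exact: L1_cas.
rewrite (Rintegral_swap kt ks ik); apply: eq_Rintegral => s _.
transitivity (\int[mu]_t (f s * (damp y t * (cas (2 * pi * x * t) * cas (2 * pi * s * t))))).
  by apply: eq_Rintegral => t _; rewrite kE.
by rewrite (RintegralZl _ _ (lcc s))// Rintegral_damp_cas// mulrC.
Qed.

(** * Abel means of the squared transform and the autocorrelation *)

Definition translation_sq f (h : R) := \int[mu]_x ((f (x + h) - f x) ^+ 2).

Section autocorrelation.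
Variable f : R -> R.
Hypothesis l2f : L2 mu f.
Let N := \int[mu]_x (f x ^+ 2).

Let mf : measurable_fun [set: R] f. Proof. by case: l2f. Qed.

Let N_shift h : \int[mu]_x (f (x + h) ^+ 2) = N.
Proof. by rewrite (Rintegral_shift h (measurable_sqr mf)). Qed.

Lemma translation_sq_ge0 h : 0 <= translation_sq f h.
Proof. by apply: Rintegral_ge0 => x _; exact: sqr_ge0. Qed.

Lemma autocorrelationE h : \int[mu]_x (f x * f (x + h)) = N - 2^-1 * translation_sq f h.
Proof.
have l2h := L2_shift h l2f.
have -> : translation_sq f h = \int[mu]_x (f (x + h) ^+ 2 + f x ^+ 2 - 2 * (f x * f (x + h))).
  by apply: eq_Rintegral => x _; ring.
have [a1 a2] := (L2_sqr l2h, L2_sqr l2f); have a3 := L2M l2f l2h.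
rewrite RintegralB//; [|exact: L1D|exact: L1Z].
rewrite RintegralD// RintegralZl// N_shift -/N.
by field.
Qed.

Lemma autocorrelation_le h : \int[mu]_x `|f x * f (x + h)| <= N.
Proof.
have l2h := L2_shift h l2f.
have [a1 a2] := (L2_sqr l2h, L2_sqr l2f); have a3 := L2M l2f l2h.
apply: (@le_trans _ _ (\int[mu]_x (2^-1 * (f x ^+ 2 + f (x + h) ^+ 2)))).
  apply: le_Rintegral => //; first exact: L1_norm.
    by apply: L1Z; exact: L1D.
  move=> x _; rewrite normrM -(real_normK (num_real (f x))).
  rewrite -(real_normK (num_real (f (x + h)))).
  by have := sqr_ge0 (`|f x| - `|f (x + h)|); nra.
rewrite RintegralZl//; last exact: L1D.
by rewrite RintegralD// N_shift -/N; lra.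
Qed.

Lemma translation_sq_le h : translation_sq f h <= 4 * N.
Proof.
have := autocorrelationE h.
have := le_trans (le_normr_Rintegral measurableT (L2M l2f (L2_shift h l2f))) (autocorrelation_le h).
rewrite ler_norml => /andP[h1 _] E.
rewrite E in h1; lra.
Qed.

Hypothesis l1f : L1 mu f.

(** Expanding one factor [hartley f t] gives the pairing of [f] with its Poisson integral. The
    substitution [s = x + h] and a second exchange turn it into an average of the autocorrelation,
    and the kernel has mass 1. *)
Lemma damp_hartley_sq y : 0 < y ->
  L1 mu (fun h => poisson_kernel y h * translation_sq f h) /\
  \int[mu]_t (damp y t * hartley f t ^+ 2) = N - 2^-1 * \int[mu]_h (poisson_kernel y h * translation_sq f h).
Proof.
move=> y0; have l1H := L1_damp_bdd y0 (measurable_hartley l1f) (fun t => hartley_le t l1f).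
(* The other factor [hartley f t] stays unexpanded; being bounded, it is integrable once damped. *)
pose k (t x : R) := damp y t * hartley f t * (cas (2 * pi * x * t) * f x).
have mk : measurable_fun [set: measurableTypeR R * measurableTypeR R]
    (fun z => k z.1 z.2).
  apply: measurable_funM; first exact: (measurableT_comp (L1_measurable l1H)).
  by apply: measurable_funM; [exact: measurable_cas2|exact: (measurableT_comp mf)].
have kt t : L1 mu (k t) by apply: L1Z; exact: L1_cas.
have kE x t : k t x = f x * (damp y t * cas (2 * pi * x * t) * hartley f t).
  by rewrite /k; ring.
have ldh x : L1 mu (fun t => damp y t * cas (2 * pi * x * t) * hartley f t).
  rewrite (_ : (fun _ => _) =
    (fun t => cas (2 * pi * x * t) * (damp y t * hartley f t))); last first.
    by apply/funext => t; ring.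
  by apply: (L1_bdd _ _ l1H); [exact: measurable_casr|move=> t; exact: cas_le2].
have kx x : L1 mu (fun t => k t x) by rewrite (funext (kE x)); exact: L1Z.
have ik : (mu \x mu)%E.-integrable setT (fun z => (k z.1 z.2)%:E).
  apply: (L1_integrable_prodM mk kx (a := fun t => 2 * `|damp y t * hartley f t|)
    (b := fun x => `|f x|)).
  - move=> t x; rewrite normrM [leRHS]mulrAC [leRHS]mulrC ler_wpM2l//.
    by rewrite normrM ler_wpM2r// cas_le2.
  - exact/L1Z/L1_norm.
  - exact: L1_norm.
pose k2 (x h : R) := f x * (poisson_kernel y h * f (x + h)).
have mk2 : measurable_fun [set: measurableTypeR R * measurableTypeR R]
    (fun z => k2 z.1 z.2).
  apply: measurable_funM; first exact: (measurableT_comp mf).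
  apply: measurable_funM; first exact: (measurableT_comp (measurable_poisson_kernel y0)).
  apply: (measurableT_comp mf).
  exact: measurable_funD.
have k2x x : L1 mu (k2 x).
  apply: L1Z; apply: L1_bdd; [exact: measurable_poisson_kernel|by move=> s; exact: poisson_kernel_le|].
  by have := L1_shift x l1f; under eq_fun do rewrite addrC.
have k2E h x : k2 x h = poisson_kernel y h * (f x * f (x + h)) by rewrite /k2; ring.
have lfh h := L2M l2f (L2_shift h l2f).
have k2h h : L1 mu (fun x => k2 x h) by rewrite (funext (k2E h)); exact: L1Z.
have k2B h : \int[mu]_x `|k2 x h| <= N * poisson_kernel y h.
  rewrite (_ : \int[mu]_x _ = poisson_kernel y h * \int[mu]_x `|f x * f (x + h)|).
    by rewrite mulrC ler_wpM2r ?poisson_kernel_ge0// autocorrelation_le.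
  rewrite -(RintegralZl _ _ (L1_norm (lfh h)))//.
  by apply: eq_Rintegral => x _; rewrite k2E normrM ger0_norm ?poisson_kernel_ge0.
have lNpk : L1 mu (fun h => N * poisson_kernel y h) by exact/L1Z/L1_poisson_kernel.
have ik2 := L1_integrable_prod mk2 k2h k2B lNpk.
have Ak2 h : \int[mu]_x k2 x h = poisson_kernel y h * N - 2^-1 * (poisson_kernel y h * translation_sq f h).
  transitivity (\int[mu]_x (poisson_kernel y h * (f x * f (x + h)))).
    by apply: eq_Rintegral => x _; rewrite k2E.
  by rewrite (RintegralZl _ _ (lfh h))// autocorrelationE; ring.
have lA : L1 mu (fun h => poisson_kernel y h * translation_sq f h).
  (* Integrability, and with it measurability in [h], is inherited from the partial integral of [k2]
     by solving [autocorrelationE] for [translation_sq]. *)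
  rewrite (_ : (fun _ => _) = fun h => 2 * (N * poisson_kernel y h - \int[mu]_x k2 x h)).
    by apply: L1Z; apply: L1B => //; exact: (L1_Rintegral2 mk2 k2h k2B lNpk).
  by apply/funext => h; rewrite Ak2; field.
split=> //.
transitivity (\int[mu]_t \int[mu]_x k t x).
  apply: eq_Rintegral => t _; rewrite /k RintegralZl//; last exact: L1_cas.
  by rewrite -/(hartley f t); ring.
rewrite (Rintegral_swap kt kx ik).
transitivity (\int[mu]_x \int[mu]_h k2 x h).
  apply: eq_Rintegral => x _.
  transitivity (\int[mu]_t (f x * (damp y t * cas (2 * pi * x * t) * hartley f t))).
    by apply: eq_Rintegral => t _; rewrite kE.
  rewrite (RintegralZl _ _ (ldh x))// damp_cas_hartley//.
  have lpf : L1 mu (fun h => poisson_kernel y h * f (x + h)).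
    apply: L1_bdd; [exact: measurable_poisson_kernel|by move=> s; exact: poisson_kernel_le|].
    by have := L1_shift x l1f; under eq_fun do rewrite addrC.
  rewrite /k2 RintegralZl//; congr (_ * _).
  rewrite -(Rintegral_shift x (L1_measurable (L1_poisson_kernelM x y0 l1f))).
  by apply: eq_Rintegral => h _; rewrite opprD addrCA subrr addr0 poisson_kernelN addrC.
rewrite (Rintegral_swap k2x k2h ik2).
transitivity (\int[mu]_h (N * poisson_kernel y h - 2^-1 * (poisson_kernel y h * translation_sq f h))).
  by apply: eq_Rintegral => h _; rewrite Ak2 mulrC.
rewrite (RintegralB measurableT lNpk (L1Z 2^-1 lA)) (RintegralZl _ _ (L1_poisson_kernel y0))//.
by rewrite (RintegralZl _ _ lA)// Rintegral_poisson_kernel// mulr1.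
Qed.

End autocorrelation.


(** * Continuity of translations in L2 *)

Definition clip (M v : R) := (`|v + M| - `|v - M|) / 2.

Lemma continuous_clip M : continuous (clip M).
Proof.
move=> v; apply: cvgMl; apply: cvgB; apply: cvg_norm.
  by apply: cvgD => //; exact: cvg_cst.
by apply: cvgB => //; exact: cvg_cst.
Qed.

Lemma clip_le M v : 0 <= M -> `|clip M v| <= M.
Proof.
move=> M0; rewrite ler_norml /clip.
by case: (ger0P (v + M)) => h1; case: (ger0P (v - M)) => h2; apply/andP; split; lra.
Qed.

(** Clipping is the nearest-point projection onto [[- M, M]], so it cannot move [v] away from a
    point of that interval. *)
Lemma clip_dist M v w : `|w| <= M -> `|w - clip M v| <= `|w - v|.
Proof.
rewrite ler_norml /clip => /andP[h1 h2].
case: (ger0P (v + M)) => h3; case: (ger0P (v - M)) => h4; case: (ger0P (w - v)) => h5;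
  by rewrite ler_norml; apply/andP; split; lra.
Qed.

(** A trapezoid: 1 up to [|x| = L], 0 from [L + 1] on, of slope -1 in [|x|] between. *)
Definition cutoff (L x : R) := clip 2^-1 (L + 2^-1 - `|x|) + 2^-1.

Lemma continuous_cutoff L : continuous (cutoff L).
Proof.
move=> x; apply: (@cvgD _ R^o); last exact: cvg_cst.
apply: (@cvg_comp _ _ _ (fun x : R => L + 2^-1 - `|x|) (clip 2^-1) _
  (nbhs (L + 2^-1 - `|x|))); last exact: continuous_clip.
by apply: (@cvgB _ R^o); [exact: cvg_cst|exact: norm_continuous].
Qed.

Lemma cutoff_in L x : `|x| <= L -> cutoff L x = 1.
Proof. by rewrite /cutoff /clip; move: `|x| => a h; rewrite !ger0_norm; lra. Qed.

Lemma cutoff_out L x : L + 1 <= `|x| -> cutoff L x = 0.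
Proof. by rewrite /cutoff /clip; move: `|x| => a h; rewrite !ler0_norm; lra. Qed.

Lemma cutoff_01 L x : 0 <= cutoff L x <= 1.
Proof.
have := clip_le (L + 2^-1 - `|x|) (_ : 0 <= 2^-1 :> R); rewrite ler_norml.
by move=> /(_ ltac:(by [])) /andP[h1 h2]; rewrite /cutoff; apply/andP; split; lra.
Qed.

Lemma L1_ball (C L : R) : L1 mu (fun x : R => C * \1_(`[- L, L]%classic) x).
Proof.
apply: L1Z; apply/integrableP; split.
  by apply/measurable_EFinP; exact: measurable_indic.
under eq_integral do rewrite gee0_abs ?lee_fin//.
pose B : set R := `[- L, L]%classic.
have -> : (\int[mu]_x (EFin \o \1_B) x = mu B)%E.
  have mB : measurable (B : set (measurableTypeR R)) by exact: measurable_itv.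
  by have := integral_indic mu measurableT mB; rewrite setIT.
rewrite /B lebesgue_measure_itv/=.
by case: ifPn => _; rewrite ?ltry// -EFinB ltry.
Qed.

Lemma translation_sq_cvg_compact_support (G : R -> R) (M L : R) (u : nat -> R) :
  continuous G -> (forall x, `|G x| <= M) -> (forall x, L <= `|x| -> G x = 0) ->
  (forall k, `|u k| <= 1) -> u k @[k --> \oo] --> 0 ->
  translation_sq G (u k) @[k --> \oo] --> 0.
Proof.
move=> cG GM GL u1 u0.
have mG : measurable_fun [set: R] G by exact: continuous_measurable_fun.
have -> : 0 = \int[mu]_x (cst 0 x : R) by rewrite Rintegral_cst// mul0r.
(* Since [|u k| <= 1], all the differences vanish beyond [L + 1], so one dominating function serves
   every [k]. *)
have lg := L1_ball ((2 * M) ^+ 2) (L + 1).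
apply: (cvg_Rintegral _ _ _ lg) => //.
- move=> k; apply: measurable_sqr; apply: measurable_funB => //.
  by apply: (measurableT_comp mG); exact: measurable_funD.
- move=> x; rewrite (_ : cst 0 x = (G (x + 0) - G x) ^+ 2); last first.
    by rewrite addr0 subrr expr0n.
  apply: (@cvg_comp _ _ _ (fun k => x + u k) (fun z => (G z - G x) ^+ 2) _ (nbhs (x + 0))).
    by apply: cvgD => //; exact: cvg_cst.
  apply: (@cvg_comp _ _ _ (fun z => G z - G x) (fun z => z ^+ 2) _
    (nbhs (G (x + 0) - G x))); last exact: exprn_continuous.
  by apply: (@cvgB _ R^o); [exact: cG|exact: cvg_cst].
- move=> n x; rewrite ger0_norm ?sqr_ge0// indicE.
  have [xL|xL] := leP `|x| (L + 1).
    rewrite mem_set/=; last by rewrite in_itv/= -ler_norml.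
    rewrite mulr1 -[leLHS]ger0_norm ?sqr_ge0// normrX ler_sqr ?nnegrE//; last first.
      by rewrite mulr_ge0// (le_trans _ (GM 0)).
    by rewrite (le_trans (ler_normB _ _))// mulr_natl mulr2n lerD.
  have -> : G (x + u n) = 0.
    by apply: GL; have := ler_normB (x + u n) (u n); rewrite addrK; have := u1 n; lra.
  have -> : G x = 0 by apply: GL; lra.
  by rewrite subrr expr0n mulr_ge0 ?sqr_ge0.
Qed.

Definition trunc f (n : nat) (x : R) :=
  if (`|x| <= n%:R) && (`|f x| <= n%:R) then f x else 0.

Lemma measurable_trunc f n : measurable_fun [set: R] f -> measurable_fun [set: R] (trunc f n).
Proof.
move=> mf; apply: measurable_fun_ifT => //; apply: measurable_and.
  by apply: measurable_fun_ler => //; exact: measurableT_comp.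
by apply: measurable_fun_ler => //; exact: measurableT_comp.
Qed.

Lemma L2_truncation f e : L2 mu f -> 0 < e -> exists n : nat,
  \int[mu]_x ((f x - trunc f n x) ^+ 2) <= e.
Proof.
move=> l2f e0; have [mf _] := l2f.
suff h0 : \int[mu]_x ((f x - trunc f n x) ^+ 2) @[n --> \oo] --> (0 : R).
  move/cvgrPdist_le : h0 => /(_ _ e0)[n _ /(_ n (leqnn n))] /= h.
  by exists n; rewrite (le_trans (ler_norm _))// -normrN -sub0r.
have -> : 0 = \int[mu]_x (cst 0 x : R) by rewrite Rintegral_cst// mul0r.
apply: (cvg_Rintegral _ _ _ (L2_sqr l2f)) => //.
- move=> n; apply: measurable_sqr; apply: measurable_funB => //.
  exact: measurable_trunc.
- move=> x; apply/cvgrPdist_le => d d0; near=> n.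
  have h : Num.max `|x| `|f x| <= n%:R by near: n; exact: nbhs_infty_ger.
  move: h; rewrite ge_max => h.
  by rewrite /trunc h subrr expr0n subrr normr0 ltW.
- move=> n x; rewrite ger0_norm ?sqr_ge0// /trunc.
  by case: ifPn; rewrite ?subr0// subrr expr0n sqr_ge0.
Unshelve. all: by end_near. Qed.

(** Continuous functions approximate the truncation [phi] in L1 on a bounded interval. Clipping and
    cutting off do not increase the distance to [phi] and bound the difference by [2 * M], so L1
    smallness becomes L2 smallness. *)
Lemma L2_approx f e : L2 mu f -> 0 < e -> exists G : R -> R, exists M L : R,
  [/\ continuous G, forall x, `|G x| <= M, forall x, L <= `|x| -> G x = 0,
      L2 mu G & \int[mu]_x ((f x - G x) ^+ 2) <= e].
Proof.
move=> l2f e0; have [mf _] := l2f.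
have e4 : 0 < e / 4 by rewrite divr_gt0.
have [n fn] := L2_truncation l2f e4.
pose M : R := n%:R; pose phi := trunc f n.
have M0 : 0 <= M by rewrite /M.
have mphi : measurable_fun [set: R] phi by exact: measurable_trunc.
have phiM x : `|phi x| <= M.
  by rewrite /phi /trunc; case: ifPn => [/andP[]//|_]; rewrite normr0.
have phi_out x : M < `|x| -> phi x = 0.
  by rewrite /phi /trunc -/M leNgt => ->.
(* One unit wider than the interval carrying [phi], so that the ramp of the cutoff lies inside. *)
pose E : set R := `[- (M + 1), M + 1]%classic.
have mE : measurable (E : set (measurableTypeR R)) by exact: measurable_itv.
have inE1 x : (x \in E) = (`|x| <= M + 1).
  rewrite ler_norml; apply/idP/idP => [/set_mem|h]; first by rewrite /E/= in_itv.
  by apply/mem_set; rewrite /E/= in_itv.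
have bd (b : R -> R) : measurable_fun [set: R] b -> (forall x, `|b x| <= M) ->
    (forall x, M + 1 < `|x| -> b x = 0) -> L1 mu b.
  move=> mb bM b0; apply: (le_L1 _ _ (L1_ball M (M + 1))) => [//|x].
  rewrite indicE -/E inE1; have [_|h] /= := leP `|x| (M + 1); first by rewrite mulr1.
  by rewrite b0// normr0 mulr0.
have l1phi : L1 mu phi by apply: bd => // x h; apply: phi_out; lra.
have finE : (mu E < +oo)%E.
  by rewrite /E lebesgue_measure_itv/=; case: ifPn => _; rewrite ?ltry// -EFinB ltry.
have intE : mu.-integrable E (EFin \o phi) by exact: (integrableS measurableT).
have [g_ [cg ig /fine_cvgP[g_fin /cvgrPdist_le g_cvg]]] :=
  approximation_continuous_integrable mE finE intE.
(* Chosen so that [2 * (M + 1) * r = e / 4]. Both errors are then at most [e / 4], and each is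
   doubled when the squares are combined. *)
pose r := e / (8 * (M + 1)).
have r0 : 0 < r by rewrite divr_gt0// mulr_gt0// ltr_pwDr.
have [m [mfin mr]] : exists m, (\int[mu]_(z in E) `|(phi z - g_ m z)%:E|)%E \is a fin_num /\
    fine (\int[mu]_(z in E) `|(phi z - g_ m z)%:E|)%E <= r.
  have [m _ /(_ m (leqnn m))[/= h1 h2]] : \forall m \near \oo,
     (\int[mu]_(z in E) `|(phi z - g_ m z)%:E|)%E \is a fin_num /\
     `|0 - fine (\int[mu]_(z in E) `|(phi z - g_ m z)%:E|)%E| <= r.
    by near=> m; split; near: m; [exact: g_fin|exact: g_cvg].
  by exists m; split => //; rewrite (le_trans _ h2)// sub0r normrN ler_norm.
pose G (x : R) : R := clip M (g_ m x) * cutoff M x.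
have cG : continuous G.
  move=> x; apply: (@cvgM R); last exact: continuous_cutoff.
  apply: (@cvg_comp _ _ _ (g_ m) (clip M) _ (nbhs (g_ m x))); first exact: cg.
  exact: continuous_clip.
have mG : measurable_fun [set: R] G by exact: continuous_measurable_fun.
have GM x : `|G x| <= M.
  rewrite normrM -[leRHS]mulr1 ler_pM// ?clip_le//.
  by have /andP[h1 h2] := cutoff_01 M x; rewrite ger0_norm.
have G0 x : M + 1 <= `|x| -> G x = 0 by move=> h; rewrite /G cutoff_out// mulr0.
have l1G : L1 mu G by apply: bd => // x h; apply: G0; exact: ltW.
have l2G : L2 mu G by exact: (@L1_bdd_L2 _ _ _ mu M).
have l2phi : L2 mu phi by exact: (@L1_bdd_L2 _ _ _ mu M).
exists G, M, (M + 1); split => //.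
pose h (x : R) : R := `|phi x - g_ m x| * \1_E x.
have phiG x : `|phi x - G x| <= h x.
  rewrite /h indicE inE1; have [xM1|xM1] /= := leP `|x| (M + 1); last first.
    have Mx : M < `|x| by rewrite (lt_trans _ xM1)// ltrDl.
    by rewrite (G0 _ (ltW xM1)) (phi_out _ Mx) subrr normr0 mulr0.
  rewrite mulr1; have [xM|xM] := leP `|x| M.
    by rewrite /G cutoff_in// mulr1 clip_dist.
  rewrite phi_out// !sub0r !normrN /G normrM.
  rewrite (@le_trans _ _ `|clip M (g_ m x)|)//.
    rewrite ler_piMr//; have /andP[h1 h2] := cutoff_01 M x.
    by rewrite ger0_norm.
  have := @clip_dist M (g_ m x) 0; rewrite !sub0r !normrN; apply.
  by rewrite normr0.
have hE : (\int[mu]_x (h x)%:E)%E = (\int[mu]_(z in E) `|(phi z - g_ m z)%:E|)%E.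
  rewrite [RHS]integral_mkcond; apply: eq_integral => x _.
  by rewrite /h patchE indicE; case: (x \in E); rewrite ?mulr1 ?mulr0.
have mh : measurable_fun [set: R] h.
  apply: measurable_funM; last exact: measurable_indic.
  apply: measurableT_comp => //; apply: measurable_funB => //.
  exact: continuous_measurable_fun.
have h0 x : 0 <= h x by rewrite /h mulr_ge0.
have l1h : L1 mu h.
  apply/integrableP; split; first exact/measurable_EFinP.
  under eq_integral do rewrite gee0_abs ?lee_fin//.
  by rewrite hE -ge0_fin_numE// integral_ge0.
have hr : \int[mu]_x h x <= r by rewrite /Rintegral hE.
have l2a := L2_sqr (L2B l2f l2phi); have l2b := L2_sqr (L2B l2phi l2G).
have bnd2 : \int[mu]_x ((phi x - G x) ^+ 2) <= e / 4.
  apply: (@le_trans _ _ (\int[mu]_x (2 * M * h x))).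
    apply: le_Rintegral => //; first exact: L1Z.
    move=> x _; rewrite -[leLHS]ger0_norm ?sqr_ge0// normrX expr2 ler_pM//.
    by rewrite (le_trans (ler_normB _ _))// mulr_natl mulr2n lerD.
  rewrite RintegralZl//; apply: (@le_trans _ _ (2 * M * r)).
    by rewrite ler_wpM2l// mulr_ge0.
  apply: (@le_trans _ _ (2 * (M + 1) * r)).
    by rewrite ler_wpM2r ?(ltW r0)// ler_wpM2l// lerDl.
  rewrite le_eqVlt; apply/predU1P; left; rewrite /r; field.
  by rewrite gt_eqF// ltr_pwDr.
apply: (@le_trans _ _ (\int[mu]_x (2 * (f x - phi x) ^+ 2 + 2 * (phi x - G x) ^+ 2))).
  apply: le_Rintegral => //; first exact: L2_sqr (L2B l2f l2G).
    by apply: L1D; exact: L1Z.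
  move=> x _; have := sqr_ge0 ((f x - phi x) - (phi x - G x)); nra.
rewrite (RintegralD _ (L1Z 2 l2a) (L1Z 2 l2b))// !RintegralZl//.
move: fn bnd2; rewrite -/phi; lra.
Unshelve. all: by end_near. Qed.

(** Argued by contradiction, because dominated convergence speaks of sequences: a failure supplies
    shifts [u k] tending to 0 that a continuous approximant of compact support refutes. *)
Lemma translation_sq_cvg0 f e : L2 mu f -> 0 < e ->
  exists2 d : R, 0 < d & forall h, `|h| < d -> translation_sq f h <= e.
Proof.
move=> l2f e0; apply: contrapT => /forall2NP nh.
(* A sum of three terms costs a factor 3 in squares: two errors of [e / 24] and one of [e / 4] add
   up to [e]. *)
have e12 : 0 < e / 24 by rewrite divr_gt0.
have [G [M [L [cG GM GL l2G fG]]]] := L2_approx l2f e12.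
have uP (k : nat) : exists h, `|h| < k.+1%:R^-1 /\ e < translation_sq f h.
  have [|/existsNP[h /not_implyP[h1 h2]]] := nh k.+1%:R^-1.
    by rewrite invr_gt0.
  by exists h; split => //; rewrite ltNge; exact/negP.
have [u up] := choice uP.
have u0 : u k @[k --> \oo] --> 0.
  apply/cvgr0Pnorm_lt => d d0; near=> k.
  have [h1 _] := up k; rewrite (lt_le_trans h1)// ltW//.
  by near: k; exact: (near_infty_natSinv_lt (PosNum d0)).
have u1 k : `|u k| <= 1.
  by have [h1 _] := up k; rewrite (le_trans (ltW h1))// invf_le1// ler1n.
have e4 : 0 < e / 4 by rewrite divr_gt0.
have /cvgrPdist_lt/(_ _ e4)[k _ /(_ k (leqnn k))] :=
  translation_sq_cvg_compact_support cG GM GL u1 u0.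
rewrite /= sub0r normrN (ger0_norm (translation_sq_ge0 _ _)) => Gk.
have [_ fk] := up k.
have l2fs := L2_shift (u k) l2f; have l2Gs := L2_shift (u k) l2G.
have l2d := L2B l2f l2G; have l2ds := L2_shift (u k) l2d.
have dE : \int[mu]_x ((f (x + u k) - G (x + u k)) ^+ 2) = \int[mu]_x ((f x - G x) ^+ 2).
  have [md _] := l2d.
  by rewrite -(Rintegral_shift (u k) (measurable_sqr md)).
have : translation_sq f (u k) <= \int[mu]_x (3 * (f (x + u k) - G (x + u k)) ^+ 2 +
    3 * (f x - G x) ^+ 2 + 3 * (G (x + u k) - G x) ^+ 2).
  apply: le_Rintegral => //.
  - exact: L2_sqr (L2B l2fs l2f).
  - apply: L1D; last exact: L1Z (L2_sqr (L2B l2Gs l2G)).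
    by apply: L1D; [exact: L1Z (L2_sqr l2ds)|exact: L1Z (L2_sqr l2d)].
  - move=> x _.
    set a := f _; set b := f _; set c := G _; set d := G _.
    have := sqr_ge0 ((a - c) + (b - d)); have := sqr_ge0 ((a - c) - (c - d)).
    have := sqr_ge0 ((b - d) + (c - d)).
    by nra.
rewrite RintegralD//; last first.
- exact: L1Z (L2_sqr (L2B l2Gs l2G)).
- by apply: L1D; [exact: L1Z (L2_sqr l2ds)|exact: L1Z (L2_sqr l2d)].
rewrite (RintegralD _ (L1Z 3 (L2_sqr l2ds)) (L1Z 3 (L2_sqr l2d)))//.
rewrite (RintegralZl _ _ (L2_sqr l2ds))// (RintegralZl _ _ (L2_sqr l2d))//.
rewrite (RintegralZl _ _ (L2_sqr (L2B l2Gs l2G)))// dE -/(translation_sq G (u k)).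
by lra.
Unshelve. all: by end_near. Qed.

(** * The limit [y -> 0] and Plancherel on L1 and L2 *)

Lemma poisson_kernel_le_far y h d : 0 < y -> 0 < d -> d <= `|h| ->
  poisson_kernel y h <= y * (1 + d ^- 2) * poisson_kernel 1 h.
Proof.
move=> y0 d0 dh; rewrite /poisson_kernel [leRHS]mulrCA ler_wpM2l ?invr_ge0 ?pi_ge0//.
rewrite -[leRHS]mulrA ler_wpM2l ?(ltW y0)//.
have d2 : 0 < d ^+ 2 by rewrite exprn_gt0.
have dh2 : d ^+ 2 <= h ^+ 2.
  by rewrite -(real_normK (num_real h)) ler_sqr ?nnegrE// ltW.
have h2 : 0 < h ^+ 2 by rewrite (lt_le_trans d2).
rewrite div1r expr1n; apply: (@le_trans _ _ (h ^+ 2)^-1).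
  by rewrite lef_pV2 ?posrE ?lerDr ?sqr_ge0// ltr_pwDr// sqr_ge0.
rewrite ler_pdivlMr ?ltr_pwDl ?sqr_ge0// mulrDr mulr1 mulVf ?gt_eqF// addrC lerD2l.
by rewrite lef_pV2 ?posrE.
Qed.

(** The kernel is an approximate identity: for [|h| < d] the other factor is at most [e / 2] and the
    kernel has mass 1; for [|h| >= d] that factor is at most [4 * N] and the kernel is [y] times a
    fixed integrable function. *)
Lemma cvg_poisson_kernel_translation_sq f : L1 mu f -> L2 mu f ->
  \int[mu]_h (poisson_kernel n.+1%:R^-1 h * translation_sq f h) @[n --> \oo] --> (0 : R).
Proof.
move=> l1f l2f; set N := \int[mu]_x (f x ^+ 2).
have N0 : 0 <= N by apply: Rintegral_ge0 => x _; exact: sqr_ge0.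
apply/cvgrPdist_le => e e0.
have e2 : 0 < e / 2 by rewrite divr_gt0.
have [d d0 fd] := translation_sq_cvg0 l2f e2.
pose C := 4 * N * (1 + d ^- 2).
have C0 : 0 <= C by rewrite !mulr_ge0// addr_ge0// invr_ge0 sqr_ge0.
have eC : 0 < e / (2 * (C + 1)) by rewrite divr_gt0// mulr_gt0// ltr_pwDr.
near=> n.
have ye : n.+1%:R^-1 < e / (2 * (C + 1)).
  by near: n; exact: (near_infty_natSinv_lt (PosNum eC)).
set y : R := n.+1%:R^-1 in ye *.
have y0 : 0 < y by rewrite invr_gt0.
have [lpd _] := damp_hartley_sq l2f l1f y0.
have [l1 l2] := (L1_poisson_kernel y0, L1_poisson_kernel (@ltr01 R)).
rewrite sub0r normrN ger0_norm; last first.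
  by apply: Rintegral_ge0 => h _; rewrite mulr_ge0 ?poisson_kernel_ge0 ?translation_sq_ge0.
apply: (@le_trans _ _ (\int[mu]_h (e / 2 * poisson_kernel y h + y * C * poisson_kernel 1 h))).
  apply: le_Rintegral => //; first by apply: L1D; exact: L1Z.
  move=> h _; have [dh|hd] := leP d `|h|.
    apply: (@le_trans _ _ (y * C * poisson_kernel 1 h)); last first.
      by rewrite lerDr mulr_ge0 ?poisson_kernel_ge0// ltW.
    rewrite (_ : y * C * poisson_kernel 1 h = y * (1 + d ^- 2) * poisson_kernel 1 h * (4 * N)); last first.
      by rewrite /C; ring.
    rewrite ler_pM ?poisson_kernel_ge0 ?translation_sq_ge0 ?poisson_kernel_le_far//.
    exact: translation_sq_le.
  apply: (@le_trans _ _ (e / 2 * poisson_kernel y h)).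
    by rewrite mulrC ler_wpM2r ?poisson_kernel_ge0 ?fd.
  by rewrite lerDl mulr_ge0 ?poisson_kernel_ge0// mulr_ge0// ltW.
rewrite (RintegralD _ (L1Z (e / 2) l1) (L1Z (y * C) l2))//.
rewrite (RintegralZl _ _ l1)// (RintegralZl _ _ l2)// !Rintegral_poisson_kernel// !mulr1.
rewrite [leRHS]splitr lerD2l (le_trans (_ : _ <= y * (C + 1)))//.
  by rewrite ler_wpM2l ?(ltW y0)// lerDl.
rewrite -ler_pdivlMr ?ltr_pwDr// (le_trans (ltW ye))// le_eqVlt; apply/predU1P; left.
by field; rewrite gt_eqF// ltr_pwDr.
Unshelve. all: by end_near. Qed.

(** As [y = 1 / (n + 1)] decreases, [damp y] increases to 1, so monotone convergence applies and
    finiteness of the left-hand side comes out as a result. *)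
Lemma hartley_N2 f : L1 mu f -> L2 mu f -> N2 mu (hartley f) = N2 mu f.
Proof.
move=> l1f l2f; have mH := measurable_hartley l1f.
pose yn (n : nat) : R := n.+1%:R^-1.
have yn0 n : 0 < yn n by rewrite invr_gt0.
pose g (n : nat) (t : R) : \bar R := (damp (yn n) t * hartley f t ^+ 2)%:E.
have mg n : measurable_fun [set: R] (g n).
  by apply/measurable_EFinP; apply: measurable_funM; [exact: measurable_damp|exact: measurable_sqr].
have g0 n t : (0 <= g n t)%E by rewrite lee_fin mulr_ge0 ?damp_ge0 ?sqr_ge0.
have nd t : {homo g ^~ t : n m / (n <= m)%N >-> (n <= m)%E}.
  move=> n m nm; rewrite lee_fin ler_wpM2r ?sqr_ge0// /damp ler_expR lerN2.
  rewrite ler_wpM2r// ler_wpM2l ?mulr_ge0 ?pi_ge0//.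
  by rewrite /yn lef_pV2 ?posrE// ler_nat.
have glim t : limn (g ^~ t) = (hartley f t ^+ 2)%:E.
  apply/cvg_lim => //; apply: cvg_EFin; first exact: nearW.
  rewrite -[X in _ --> X]mul1r; apply: cvgM; last exact: cvg_cst.
  rewrite -expR0 /damp; apply: (@cvg_comp _ _ _ (fun n => - (2 * pi * yn n * `|t|)) expR _ (nbhs 0));
    last exact: continuous_expR.
  rewrite -oppr0; apply: cvgN; rewrite -(mul0r `|t|); apply: cvgM; last exact: cvg_cst.
  rewrite -(mulr0 (2 * pi)); apply: cvgM; first exact: cvg_cst.
  exact: cvg_harmonic.
have h1 : (\int[mu]_t g n t)%E @[n --> \oo] --> N2 mu (hartley f).
  rewrite /N2 (_ : (\int[mu]_t (hartley f t ^+ 2)%:E)%E = (\int[mu]_t limn (g ^~ t))%E).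
    by apply: (@cvg_monotone_convergence _ _ _ mu setT measurableT g mg) => //.
  by apply: eq_integral => t _; rewrite glim.
have gE n : (\int[mu]_t g n t)%E =
    (\int[mu]_x (f x ^+ 2) - 2^-1 * \int[mu]_h (poisson_kernel (yn n) h * translation_sq f h))%:E.
  have [_ <-] := damp_hartley_sq l2f l1f (yn0 n).
  rewrite /Rintegral fineK//; apply: integrable_fin_num => //.
  apply: (@L1_damp_bdd (yn n) (fun t => hartley f t ^+ 2) ((2 * \int[mu]_x `|f x|) ^+ 2)) => //.
    exact: measurable_sqr.
  move=> t; rewrite normrX ler_sqr ?nnegrE ?hartley_le//.
  by rewrite (le_trans _ (hartley_le t l1f)).
have h2 : (\int[mu]_t g n t)%E @[n --> \oo] --> N2 mu f.
  rewrite (funext gE) N2E//; apply: cvg_EFin; first exact: nearW.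
  rewrite -[X in _ --> X]subr0 -(mulr0 2^-1); apply: cvgB; first exact: cvg_cst.
  apply: cvgM; first exact: cvg_cst.
  exact: cvg_poisson_kernel_translation_sq.
exact: (cvg_unique _ h1 h2).
Qed.

Lemma hartley_L2 f : L1 mu f -> L2 mu f -> L2 mu (hartley f).
Proof.
move=> l1f l2f; split; first exact: measurable_hartley.
by rewrite hartley_N2//; case: l2f.
Qed.

End hartley.

(** * The Hartley transform on L2, by limits *)

Section hartley_pairs.
Context (R : realType).
Notation mu := (@lebesgue_measure R).
Implicit Types (f : R -> R) (x y s t v w h d e L M : R).

Section hartley_pair.
Variables f eta : R -> R.

(* [eta] is the [L2] Hartley transform of [f]. *)
Definition hartley_pair := [/\ L2 mu f, L2 mu eta & exists phi : nat -> R -> R,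
  [/\ forall n, L1 mu (phi n), forall n, L2 mu (phi n),
      N2 mu (fun x => phi n x - f x) @[n --> \oo] --> 0%E &
      N2 mu (fun t => hartley (phi n) t - eta t) @[n --> \oo] --> 0%E]].

Hypothesis hp : hartley_pair.

Let l2f : L2 mu f. Proof. by case: hp. Qed.
Let l2eta : L2 mu eta. Proof. by case: hp. Qed.

Lemma L2_damp y : 0 < y -> L2 mu (damp y).
Proof.
move=> y0; apply: (@L1_bdd_L2 _ _ _ mu 1); last exact: L1_damp.
by move=> t; rewrite ger0_norm ?damp_ge0// damp_le1.
Qed.

Lemma L2_damp_cas y x : 0 < y -> L2 mu (fun t => damp y t * cas (2 * pi * x * t)).
Proof.
move=> y0; rewrite (_ : (fun _ => _) = (fun t => cas (2 * pi * x * t) * damp y t)).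
  by apply: (@L2_bdd _ _ _ mu _ 2 _ (measurable_casr x) _ (L2_damp y0)) => t; exact: cas_le2.
by apply/funext => t; rewrite mulrC.
Qed.

(** Both sides are pairings with fixed L2 functions, hence survive the limit from [phi n], where
    [damp_cas_hartley] gives equality. *)
Lemma hartley_pair_poisson y x : 0 < y ->
  \int[mu]_s (poisson_kernel y (x - s) * f s) = \int[mu]_t (damp y t * cas (2 * pi * x * t) * eta t).
Proof.
case: hp => _ _ [phi [l1phi l2phi phif phieta]] y0.
have l2pk : L2 mu (fun s => poisson_kernel y (x - s)).
  have l1 : L1 mu (fun s => poisson_kernel y (x - s)).
    have := L1_shift (- x) (L1_poisson_kernel y0); under eq_fun do rewrite -poisson_kernelN opprB.
    exact.
  by apply: (@L1_bdd_L2 _ _ _ mu (pi^-1 * y^-1)) => // s; exact: poisson_kernel_le.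
have h1 := cvg_pairing l2pk l2f l2phi phif.
have h2 := cvg_pairing (L2_damp_cas x y0) l2eta
  (fun n => hartley_L2 (l1phi n) (l2phi n)) phieta.
have E n : \int[mu]_s (poisson_kernel y (x - s) * phi n s) =
    \int[mu]_t (damp y t * cas (2 * pi * x * t) * hartley (phi n) t).
  by rewrite damp_cas_hartley.
move: h1; rewrite (funext E) => h1.
exact: (cvg_unique _ h1 h2).
Qed.

(* Centered differences, so that only the value at [- t] appears. *)
Lemma hartley_diff phi h t : L1 mu phi ->
  hartley (fun x => phi (x + h) - phi (x - h)) t =
  - 2 * sin (2 * pi * h * t) * hartley phi (- t).
Proof.
move=> l1; have sh a : \int[mu]_x (cas (2 * pi * x * t) * phi (x + a)) =
    \int[mu]_x (cas (2 * pi * (x - a) * t) * phi x).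
  have l1a : L1 mu (fun x => cas (2 * pi * (x - a) * t) * phi x).
    apply: (L1_bdd _ _ l1) => [|x]; last exact: cas_le2.
    apply: (measurableT_comp (measurable_casl t)).
    exact: measurable_funB.
  rewrite -(Rintegral_shift a (L1_measurable l1a)).
  by apply: eq_Rintegral => x _; rewrite addrK.
rewrite /hartley; under eq_Rintegral do rewrite mulrBr.
have l1s a : L1 mu (fun x => cas (2 * pi * x * t) * phi (x + a)).
  by apply: L1_cas; exact: L1_shift.
rewrite (RintegralB _ (l1s h) (l1s (- h)))// !sh.
have l1t a : L1 mu (fun x => cas (2 * pi * (x - a) * t) * phi x).
  apply: (L1_bdd _ _ l1) => [|x]; last exact: cas_le2.
  apply: (measurableT_comp (measurable_casl t)).
  exact: measurable_funB.
rewrite -(RintegralB _ (l1t h) (l1t (- h)))//.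
rewrite -(RintegralZl _ _ (L1_cas (- t) l1))//.
apply: eq_Rintegral => x _; rewrite -mulrBl mulrA; congr (_ * _).
rewrite mulrN (_ : 2 * pi * (x - h) * t = 2 * pi * x * t - 2 * pi * h * t); last by ring.
rewrite (_ : 2 * pi * (x - - h) * t = 2 * pi * x * t + 2 * pi * h * t); last by ring.
by rewrite /cas cosB sinB cosD sinD cosN sinN; ring.
Qed.

(** For [phi n] this is Plancherel combined with [hartley_diff]; both sides are continuous along the
    L2 approximation. *)
Lemma hartley_pair_N2_diff h : N2 mu (fun x => f (x + h) - f (x - h)) =
  N2 mu (fun t => 2 * sin (2 * pi * h * t) * eta t).
Proof.
case: hp => _ _ [phi [l1phi l2phi phif phieta]].
pose D (g : R -> R) x := g (x + h) - g (x - h).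
have l2D g : L2 mu g -> L2 mu (D g) by move=> l2g; apply: L2B; exact: L2_shift.
have l1D g : L1 mu g -> L1 mu (D g) by move=> l1g; apply: L1B; exact: L1_shift.
have mS : measurable_fun [set: R] (fun t => 2 * sin (2 * pi * h * t)).
  by apply: measurable_funM => //; exact: measurable_sinM.
have S2 t : `|2 * sin (2 * pi * h * t)| <= 2.
  by rewrite normrM ger0_norm// ler_piMr// ler_norml sin_geN1 sin_le1.
have l2S g : L2 mu g -> L2 mu (fun t => 2 * sin (2 * pi * h * t) * g t).
  by move=> l2g; apply: (@L2_bdd _ _ _ mu _ 2 _ mS S2).
have l2H n := hartley_L2 (l1phi n) (l2phi n).
have E n : N2 mu (D (phi n)) = N2 mu (fun t => 2 * sin (2 * pi * h * t) * hartley (phi n) t).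
  rewrite -(hartley_N2 (l1D _ (l1phi n)) (l2D _ (l2phi n))).
  have [mg _] := l2S _ (l2H n).
  (* Reflecting the right-hand side matches the value at [- t] in [hartley_diff]. *)
  rewrite -[RHS](N2_preserving _ (@lebesgue_measure_preimageN R) mg)//.
  apply: eq_integral => t _; rewrite hartley_diff//; congr EFin.
  by rewrite mulrN sinN; ring.
have h1 : N2 mu (D (phi n)) @[n --> \oo] --> N2 mu (D f).
  apply: cvg_N2 => [|n|]; [exact: l2D|exact: l2D|].
  have := @cvg0_N2_le _ _ _ mu (fun n x => D (phi n) x - D f x) _ 4 _ phif; apply => n.
  have l2d := L2B (l2phi n) l2f; have [md _] := l2d.
  have [l2p l2m] := (L2_shift h l2d, L2Z (-1) (L2_shift (- h) l2d)).
  have [[mp _] [mm _]] := (l2p, l2m).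
  have := N2D_le mu mp mm.
  rewrite (_ : (fun x => _ + -1 * _) = (fun x => D (phi n) x - D f x)); last first.
    by apply/funext => x; rewrite /D; ring.
  move=> /le_trans; apply.
  rewrite (N2_preserving _ (lebesgue_measure_shift h) md); last exact: measurable_funD.
  rewrite (_ : N2 mu (fun x => -1 * _) = N2 mu (fun x => phi n (x - h) - f (x - h))); last first.
    by apply: eq_integral => x _; rewrite mulN1r sqrrN.
  rewrite (N2_preserving _ (lebesgue_measure_shift (- h)) md); last exact: measurable_funD.
  by rewrite -ge0_muleDl ?lee_fin// -EFinD (_ : 2 + 2 = 4 :> R)//; ring.
have h2 : N2 mu (fun t => 2 * sin (2 * pi * h * t) * hartley (phi n) t) @[n --> \oo] -->
    N2 mu (fun t => 2 * sin (2 * pi * h * t) * eta t).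
  apply: cvg_N2 => [|n|]; [exact: l2S|exact: l2S|].
  have := @cvg0_N2_le _ _ _ mu (fun n t => 2 * sin (2 * pi * h * t) * hartley (phi n) t -
    2 * sin (2 * pi * h * t) * eta t) _ (2 ^+ 2) _ phieta; apply => n.
  have l2d := L2B (l2H n) l2eta; have [md _] := l2d.
  apply: N2_le => //; first by apply: measurable_funB; [case: (l2S _ (l2H n))|case: (l2S _ l2eta)].
  by move=> t; rewrite -mulrBr normrM ler_wpM2r.
move: h1; rewrite (funext E) => h1.
exact: (cvg_unique _ h1 h2).
Qed.

End hartley_pair.

(** * The harmonic extension and its partial derivatives *)

Section damped_hartley.
Variable eta : R -> R.
Hypothesis l2eta : L2 mu eta.

Let meta : measurable_fun [set: R] eta. Proof. by case: l2eta. Qed.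

Definition extension x y := \int[mu]_t (damp y t * cas (2 * pi * x * t) * eta t).

Definition wdamp y t := 2 * pi * `|t| * damp y t.

Lemma wdamp_ge0 y t : 0 <= wdamp y t.
Proof. by rewrite !mulr_ge0 ?damp_ge0 ?pi_ge0. Qed.

(** This is [s * exp (- s) <= 1] at [s = 2 * pi * y * |t|]. *)
Lemma wdamp_le y t : 0 < y -> wdamp y t <= y^-1.
Proof.
move=> y0; rewrite /wdamp /damp -[leRHS]mul1r ler_pdivlMr//.
have : 2 * pi * y * `|t| <= expR (2 * pi * y * `|t|).
  by rewrite (le_trans _ (expR_ge1Dx _))// lerDr.
rewrite expRN -(ler_pM2r (_ : 0 < (expR (2 * pi * y * `|t|))^-1)) ?invr_gt0 ?expR_gt0//.
by rewrite divff ?gt_eqF ?expR_gt0//; apply: le_trans; rewrite le_eqVlt; apply/predU1P; left; ring.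
Qed.

Lemma damp_half y t : damp y t = damp (y / 2) t * damp (y / 2) t.
Proof. by rewrite /damp -expRD; congr expR; field. Qed.

Lemma measurable_wdamp y : measurable_fun [set: R] (wdamp y).
Proof.
apply: measurable_funM; last exact: measurable_damp.
by apply: measurable_funM => //; exact: measurableT_comp.
Qed.

Lemma L2_wdamp y g : 0 < y -> L2 mu g -> L2 mu (fun t => wdamp y t * g t).
Proof.
move=> y0 l2g; apply: (@L2_bdd _ _ _ mu _ y^-1 _ (measurable_wdamp y)) => // t.
by rewrite ger0_norm ?wdamp_ge0// wdamp_le.
Qed.

(** Half of the damping absorbs the weight [|t|] and stays bounded, while the other half is itself
    in L2; the product of two L2 functions is in L1. *)
Lemma L1_wdamp y g : 0 < y -> L2 mu g -> L1 mu (fun t => wdamp y t * g t).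
Proof.
move=> y0 l2g; have y2 : 0 < y / 2 by rewrite divr_gt0.
rewrite (_ : (fun _ => _) = (fun t => damp (y / 2) t * (wdamp (y / 2) t * g t))).
  by apply: L2M; [exact: L2_damp|exact: L2_wdamp].
by apply/funext => t; rewrite /wdamp (damp_half y); ring.
Qed.

(* The Hartley transforms of [grad_x y] and [grad_y y] are the two partial
   derivatives of the harmonic extension at height [y]. *)
Definition grad_x y t := - (2 * pi * t) * damp y t * eta (- t).

Definition grad_y y t := - (wdamp y t * eta t).

Lemma measurable_grad_x y : measurable_fun [set: R] (grad_x y).
Proof.
apply: measurable_funM; last by exact: (measurableT_comp meta).
apply: measurable_funM; last exact: measurable_damp.
by apply: measurableT_comp => //; exact: measurable_funM.
Qed.

Lemma grad_x_norm y t : `|grad_x y t| = wdamp y t * `|eta (- t)|.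
Proof.
rewrite /grad_x /wdamp !normrM normrN !normrM (ger0_norm (damp_ge0 _ _)).
by rewrite (ger0_norm (pi_ge0 _)) ger0_norm.
Qed.

Lemma L1_grad_x y : 0 < y -> L1 mu (grad_x y).
Proof.
move=> y0; apply: (@le_L1 _ _ _ mu _ (fun t => `|wdamp y t * eta (- t)|)).
- exact: measurable_grad_x.
- by move=> t; rewrite grad_x_norm normrM (ger0_norm (wdamp_ge0 _ _)).
- by apply: L1_norm; apply: L1_wdamp => //; exact: L2_opp.
Qed.

Lemma L2_grad_x y : 0 < y -> L2 mu (grad_x y).
Proof.
move=> y0; apply: (@le_L2 _ _ _ mu _ (fun t => wdamp y t * eta (- t))).
- exact: measurable_grad_x.
- by move=> t; rewrite grad_x_norm normrM (ger0_norm (wdamp_ge0 _ _)).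
- by apply: L2_wdamp => //; exact: L2_opp.
Qed.

Lemma L1_grad_y y : 0 < y -> L1 mu (grad_y y).
Proof.
move=> y0; have := L1Z (-1) (L1_wdamp y0 l2eta).
by under eq_fun do rewrite mulN1r.
Qed.

Lemma L2_grad_y y : 0 < y -> L2 mu (grad_y y).
Proof.
move=> y0; have := L2Z (-1) (L2_wdamp y0 l2eta).
by under eq_fun do rewrite mulN1r.
Qed.

Lemma N2_grad_y y : N2 mu (grad_y y) = (\int[mu]_t (wdamp y t ^+ 2 * eta t ^+ 2)%:E)%E.
Proof. by apply: eq_integral => t _; rewrite sqrrN exprMn. Qed.

(** Up to sign the two densities are reflections of each other, so both partial derivatives carry
    the same energy on a horizontal line. *)
Lemma N2_grad_x y : N2 mu (grad_x y) = N2 mu (grad_y y).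
Proof.
rewrite -(N2_preserving _ (@lebesgue_measure_preimageN R) (measurable_grad_x y))//.
apply: eq_integral => t _; congr EFin.
rewrite -(real_normK (num_real (grad_x y (- t)))) grad_x_norm opprK.
rewrite -(real_normK (num_real (grad_y y t))) normrN normrM.
by rewrite (ger0_norm (wdamp_ge0 _ _)) /wdamp /damp normrN.
Qed.

Lemma is_derive_cas (a b : R) : is_derive b 1 (fun s => cas (a * s)) (a * cas (- (a * b))).
Proof.
rewrite /cas; apply: is_derive_eq.
by rewrite !scaleR_mul cosN sinN; ring.
Qed.

Lemma is_derive_damp t (b : R) : is_derive b 1 (fun s => damp s t) (- wdamp b t).
Proof.
rewrite /damp /wdamp /damp; apply: is_derive_eq.
by rewrite !scaleR_mul; ring.
Qed.

Lemma L1_extension x y : 0 < y ->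
  L1 mu (fun t => damp y t * cas (2 * pi * x * t) * eta t).
Proof. by move=> y0; apply: L2M => //; exact: L2_damp_cas. Qed.

Lemma derive1_extension_x x y : 0 < y ->
  derive1 (fun s => extension s y) x = hartley (grad_x y) x.
Proof.
move=> y0.
pose f s t := damp y t * cas (2 * pi * s * t) * eta t.
have df s t : is_derive s 1 (f ^~ t) (damp y t * (2 * pi * t * cas (- (2 * pi * s * t))) * eta t).
  rewrite /f (_ : (fun _ => _) = fun s => damp y t * cas (2 * pi * t * s) * eta t); last first.
    by apply/funext => r; rewrite [in LHS](_ : 2 * pi * r * t = 2 * pi * t * r)//; ring.
  have h := is_derive_cas (2 * pi * t) s.
  apply: is_derive_eq.
  by rewrite !scaleR_mul (_ : 2 * pi * s * t = 2 * pi * t * s); ring.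
pose G t := 2 * (wdamp y t * `|eta t|).
have lG : L1 mu G.
  apply: L1Z; have := L1_norm (L1_wdamp y0 l2eta).
  by under eq_fun do rewrite normrM (ger0_norm (wdamp_ge0 _ _)).
have Ix : `]x - 1, x + 1[%classic x by rewrite /= in_itv/=; lra.
have dfE s t : partial1of2 f s t = damp y t * (2 * pi * t * cas (- (2 * pi * s * t))) * eta t.
  by rewrite /partial1of2 derive1E; apply: derive_val.
have := @differentiation_under_integral R _ _ mu f setT measurableT x (x - 1) (x + 1) Ix _ _ G _ lG _.
move=> -> //.
- transitivity (\int[mu]_t (damp y t * (2 * pi * t * cas (- (2 * pi * x * t))) * eta t)).
    by apply: eq_Rintegral => t _; rewrite dfE.
  have m0 : measurable_fun [set: R] (fun t => damp y t * (2 * pi * t * cas (- (2 * pi * x * t))) * eta t).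
    apply: measurable_funM => //; apply: measurable_funM; first exact: measurable_damp.
    apply: measurable_funM; first exact: measurable_funM.
    by apply: (measurableT_comp (@measurable_cas R)); apply: measurableT_comp.
  (* Differentiating [cas] has produced [cas] at the opposite argument; replacing [t] by [- t] moves
     the reflection onto [eta], which explains the form of [grad_x]. *)
  rewrite -(Rintegral_opp m0); apply: eq_Rintegral => t _.
  rewrite (_ : - (2 * pi * x * - t) = 2 * pi * t * x); last by ring.
  by rewrite /grad_x /damp normrN; ring.
- by move=> s _; exact: L1_extension.
- by move=> t; rewrite mulr_ge0// mulr_ge0// wdamp_ge0.
- move=> s t _ _; rewrite dfE /G /wdamp !normrM (ger0_norm (damp_ge0 _ _)).
  rewrite (ger0_norm (pi_ge0 _)) (ger0_norm (_ : 0 <= 2 :> R))//.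
  have := cas_le2 (- (2 * pi * s * t)); set c := `|cas _|; set w := `|eta t|.
  move=> c2; rewrite (_ : damp y t * (2 * pi * `|t| * c) * w = c * (2 * pi * `|t| * damp y t * w)); last by ring.
  by rewrite ler_wpM2r// !mulr_ge0 ?damp_ge0 ?pi_ge0// normr_ge0.
Qed.

Lemma derive1_extension_y x y : 0 < y ->
  derive1 (fun s => extension x s) y = hartley (grad_y y) x.
Proof.
move=> y0.
pose f s t := damp s t * cas (2 * pi * x * t) * eta t.
have df s t : is_derive s 1 (f ^~ t) (- wdamp s t * cas (2 * pi * x * t) * eta t).
  have h := is_derive_damp t s.
  rewrite /f; apply: is_derive_eq.
  by rewrite !scaleR_mul; ring.
(* The heights are confined to [s > y / 2], where [wdamp s <= wdamp (y / 2)] gives a dominating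
   function independent of [s]. *)
have y2 : 0 < y / 2 by rewrite divr_gt0.
pose G t := 2 * (wdamp (y / 2) t * `|eta t|).
have lG : L1 mu G.
  apply: L1Z; have := L1_norm (L1_wdamp y2 l2eta).
  by under eq_fun do rewrite normrM (ger0_norm (wdamp_ge0 _ _)).
have Iy : `]y / 2, y + 1[%classic y by rewrite /= in_itv/=; lra.
have dfE s t : partial1of2 f s t = - wdamp s t * cas (2 * pi * x * t) * eta t.
  by rewrite /partial1of2 derive1E; apply: derive_val.
have := @differentiation_under_integral R _ _ mu f setT measurableT y (y / 2) (y + 1) Iy _ _ G _ lG _.
move=> -> //.
- apply: eq_Rintegral => t _; rewrite dfE.
  by rewrite /grad_y (_ : 2 * pi * t * x = 2 * pi * x * t); ring.
- by move=> s; rewrite /= in_itv/= => /andP[ys _]; apply: L1_extension; rewrite (lt_trans y2).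
- by move=> t; rewrite mulr_ge0// mulr_ge0// wdamp_ge0.
- move=> s t; rewrite /= in_itv/= => /andP[ys _] _.
  rewrite dfE /G !normrM normrN (ger0_norm (wdamp_ge0 _ _)) mulrAC mulrC.
  apply: ler_pM; [by []|by rewrite mulr_ge0 ?wdamp_ge0|exact: cas_le2|rewrite ler_wpM2r//].
  rewrite /wdamp ler_wpM2l ?mulr_ge0 ?pi_ge0// /damp ler_expR lerN2 ler_wpM2r//.
  by rewrite ler_wpM2l ?mulr_ge0 ?pi_ge0// ltW.
Qed.

End damped_hartley.

End hartley_pairs.

(** * Both energies in terms of the transform *)

Section dirichlet_energy.
Context (R : realType).
Notation mu := (@lebesgue_measure R).
Implicit Types (f eta : R -> R) (x y s t v w h d e a : R).

(** Tonelli on positive and negative parts, with no integrability required. The parameter space is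
    arbitrary because [energy_density] depends on the pair [(x, y)]. *)
Lemma measurable_Rintegral dT (T : measurableType dT) (k : T -> R -> R) :
  measurable_fun [set: T * measurableTypeR R] (fun z => k z.1 z.2) ->
  measurable_fun [set: T] (fun u => \int[mu]_y k u y).
Proof.
move=> mk; have mkE : measurable_fun [set: T * measurableTypeR R] (fun z => (k z.1 z.2)%:E).
  exact/measurable_EFinP.
apply: (measurableT_comp (fine_measurable measurableT)).
rewrite (_ : (fun u => _) = (fun u => fubini_F mu (fun z => (k z.1 z.2)%:E)^\+%E u -
    fubini_F mu (fun z => (k z.1 z.2)%:E)^\-%E u)%E); last first.
  apply/funext => u; rewrite [LHS]integralE /fubini_F.
  by congr (_ - _)%E; apply: eq_integral => y _; rewrite ?funeposE ?funenegE.
apply: emeasurable_funB; apply: measurable_fun_fubini_tonelli_F => //.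
  exact: measurable_funepos.
exact: measurable_funeneg.
Qed.

Lemma tonelli_swap (K : R -> R -> \bar R) :
  measurable_fun [set: measurableTypeR R * measurableTypeR R] (fun z => K z.1 z.2) ->
  (forall x y, 0 <= K x y)%E ->
  (\int[mu]_x \int[mu]_y K x y = \int[mu]_y \int[mu]_x K x y)%E.
Proof.
move=> mK K0; pose k (z : measurableTypeR R * measurableTypeR R) := K z.1 z.2.
exact: (@fubini_tonelli _ _ _ _ _ mu mu k mK (fun z => K0 z.1 z.2)).
Qed.

Lemma measurable_inv : measurable_fun [set: R] (fun x : R => x^-1).
Proof.
rewrite -(setvU [set 0]); apply/measurable_funU => //; first exact: measurableC.
split; last exact: measurable_fun_set1.
apply: open_continuous_measurable_fun; first exact/closed_openC/closed_eq.
by move=> x; rewrite inE/= => /eqP x0; exact: cvgV.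
Qed.

Lemma hartley_indic a t : 0 < a -> t != 0 ->
  hartley \1_(`[- a, a]%classic : set R) t = sin (2 * pi * a * t) / (pi * t).
Proof.
move=> a0 t0; have p0 : pi != 0 :> R by rewrite gt_eqF// pi_gt0.
(* An antiderivative of the kernel, since [- cas (- s)] has derivative [cas s]. *)
pose F x := (2 * pi * t)^-1 * - cas (- (2 * pi * t * x)).
have dF x : is_derive x 1 F (cas (2 * pi * x * t)).
  have h : is_derive x 1 (fun s => cas (- (2 * pi * t) * s)) _ := is_derive_cas (- (2 * pi * t)) x.
  rewrite /F; under eq_fun do rewrite -mulNr.
  apply: is_derive_eq.
  rewrite !scaleR_mul (_ : - (- (2 * pi * t) * x) = 2 * pi * x * t); last by ring.
  by move: (cas (2 * pi * x * t)) (pi) p0 => c p p0; field; rewrite p0 t0.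
have cF : continuous F.
  by move=> x; apply/differentiable_continuous/derivable1_diffP; have [] := dF x.
have cc : continuous (fun x => cas (2 * pi * x * t)).
  move=> x; apply: (@cvg_comp _ _ _ (fun x => 2 * pi * x * t) (@cas R) _ (nbhs (2 * pi * x * t)));
    last exact: continuous_cas.
  by apply: cvgMl; exact: cvgMr.
rewrite /hartley /Rintegral.
pose B : set R := `[- a, a]%classic; rewrite -/B.
rewrite (_ : (\int[mu]_x _)%E = (\int[mu]_(x in B) (cas (2 * pi * x * t))%:E)%E); last first.
  rewrite [RHS]integral_mkcond; apply: eq_integral => x _.
  by rewrite patchE indicE; case: ifPn => h; rewrite ?mulr1 ?mulr0.
rewrite (@continuous_FTC2 _ _ F).
- rewrite -EFinB /= /F /cas !mulrN !opprK !cosN !sinN.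
  rewrite (_ : 2 * pi * a * t = 2 * pi * t * a); last by ring.
  move: (cos (2 * pi * t * a)) (sin (2 * pi * t * a)) => C S.
  by move: (pi) p0 => p p0; field; rewrite p0 t0.
- by rewrite gtrN.
- exact: continuous_subspaceT.
- split.
  + by move=> x _; have [] := dF x.
  + by apply: cvg_at_right_filter; exact: cF.
  + by apply: cvg_at_left_filter; exact: cF.
- by move=> x _; rewrite derive1E; apply: derive_val.
Qed.

(* Plancherel for the indicator function of [[- a, a]]. *)
Lemma integral_sinc_sq a : 0 < a ->
  (\int[mu]_t ((sin (2 * pi * a * t) / (pi * t)) ^+ 2)%:E = (2 * a)%:E)%E.
Proof.
move=> a0; pose B : set R := `[- a, a]%classic.
have l1B : L1 mu (\1_B : R -> R).
  by have := L1_ball 1 a; under eq_fun do rewrite mul1r.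
have l2B : L2 mu (\1_B : R -> R).
  apply: (@L1_bdd_L2 _ _ _ mu 1) l1B => x.
  by rewrite indicE; case: (x \in B); rewrite ?normr1 ?normr0.
have mB : measurable (B : set (measurableTypeR R)) by exact: measurable_itv.
have <- : N2 mu (\1_B : R -> R) = (2 * a)%:E.
  transitivity (\int[mu]_x (\1_B x)%:E)%E.
    apply: eq_integral => x _; rewrite indicE; case: (x \in B); rewrite ?expr1n//.
    by rewrite expr0n.
  have muB : mu B = (2 * a)%:E.
    by rewrite /B lebesgue_measure_itv/= lte_fin gtrN// -EFinB; congr EFin; ring.
  by have := integral_indic mu measurableT mB; rewrite setIT => ->.
rewrite -hartley_N2//; apply: ge0_ae_eq_integral => //.
- apply: measurable_sqr_EFin; apply: measurable_funM; first exact: measurable_sinM.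
  by apply: (measurableT_comp measurable_inv); exact: measurable_funM.
- by apply: measurable_sqr_EFin; exact: measurable_hartley.
- by move=> x _; rewrite lee_fin sqr_ge0.
- by move=> x _; rewrite lee_fin sqr_ge0.
(* At [t = 0] the quotient is 0 by the convention on division, whereas the transform equals [2 * a];
   a single point is negligible. *)
- exists [set 0]; split => //; first exact: lebesgue_measure_set1.
  move=> t /=; apply: contra_notP => t0 _; rewrite hartley_indic//.
  exact/eqP.
Qed.

(** [integral_sinc_sq] with [a = |t| / 2] and [h] as the integration variable; [4 * pi ^ 2] restores
    the constants of the sine and of [pi * h]. *)
Lemma integral_sin_sq t : (\int[mu]_h ((2 * sin (pi * t * h)) ^+ 2 / h ^+ 2)%:E =
  (4 * pi ^+ 2 * `|t|)%:E)%E.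
Proof.
have [->|t0] := eqVneq t 0.
  rewrite normr0 [in RHS]mulr0; apply: integral0_eq => h _.
  by rewrite mulr0 mul0r sin0 mulr0 expr0n mul0r.
have p0 : pi != 0 :> R by rewrite gt_eqF// pi_gt0.
have t2 : 0 < `|t| / 2 by rewrite divr_gt0// normr_gt0.
transitivity (\int[mu]_h ((4 * pi ^+ 2)%:E * ((sin (2 * pi * (`|t| / 2) * h) / (pi * h)) ^+ 2)%:E))%E.
  apply: eq_integral => h _; rewrite -EFinM; congr EFin.
  rewrite (_ : 2 * pi * (`|t| / 2) * h = `|t| * (pi * h)); last by field.
  have -> : (2 * sin (pi * t * h)) ^+ 2 = 4 * sin (`|t| * (pi * h)) ^+ 2.
    have [_|_] := ger0P t.
      by rewrite (_ : t * (pi * h) = pi * t * h); ring.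
    by rewrite (_ : - t * (pi * h) = - (pi * t * h)) ?sinN; ring.
  have [->|h0] := eqVneq h 0.
    by rewrite !mulr0 sin0 !(expr0n, mulr0, mul0r).
  move: (sin (`|t| * (pi * h))) => S.
  by move: (pi) p0 => p p0; field; rewrite h0 p0.
rewrite ge0_integralZl//.
- by rewrite integral_sinc_sq// -EFinM; congr EFin; field.
- apply: measurable_sqr_EFin; apply: measurable_funM; first exact: measurable_sinM.
  by apply: (measurableT_comp measurable_inv); exact: measurable_funM.
- by move=> x _; rewrite lee_fin sqr_ge0.
- by rewrite lee_fin mulr_ge0 ?sqr_ge0.
Qed.

(** A translation by [h / 2] makes the difference centered with half step, whence the argument
    [pi * t * h] of the sine. *)
Lemma hartley_pair_N2_shift f eta h : hartley_pair f eta ->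
  N2 mu (fun x => f (x + h) - f x) =
  (\int[mu]_t ((2 * sin (pi * t * h)) ^+ 2 * eta t ^+ 2)%:E)%E.
Proof.
move=> hp; have [[mf _] _ _] := hp.
have mD : measurable_fun [set: R] (fun x => f (x + h / 2) - f (x - h / 2)).
  by apply: measurable_funB; apply: (measurableT_comp mf); exact: measurable_funD.
rewrite (_ : (fun x => _) = (fun x => f (x + h / 2 + h / 2) - f (x + h / 2 - h / 2))); last first.
  by apply/funext => x; congr (f _ - f _); field.
rewrite (N2_preserving _ (lebesgue_measure_shift (h / 2)) mD); last exact: measurable_funD.
rewrite (hartley_pair_N2_diff hp); apply: eq_integral => t _; congr EFin.
by rewrite exprMn; congr ((2 * sin _) ^+ 2 * _); field.
Qed.

(** Douglas's formula on the transform side. On the diagonal the quotient is [0 / 0 = 0], which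
    agrees with [K] at [h = 0]. *)
Lemma douglas_hartley f eta : hartley_pair f eta ->
  (\int[mu]_x2 \int[mu]_x1 ((`|f x1 - f x2| ^+ 2 / `|x1 - x2| ^+ 2)%:E) =
   (4 * pi ^+ 2)%:E * \int[mu]_t (`|t| * eta t ^+ 2)%:E)%E.
Proof.
move=> hp; have [[mf _] [meta _] _] := hp.
pose K x h := ((f (x + h) - f x) ^+ 2 / h ^+ 2)%:E.
have mK : measurable_fun [set: measurableTypeR R * measurableTypeR R] (fun z => K z.1 z.2).
  apply/measurable_EFinP; apply: measurable_funM.
    apply: measurable_funX; apply: measurable_funB; last exact: (measurableT_comp mf).
    by apply: (measurableT_comp mf); exact: measurable_funD.
  by apply: (measurableT_comp measurable_inv); exact: measurable_funX.
have K0 x h : (0 <= K x h)%E by rewrite lee_fin divr_ge0 ?sqr_ge0.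
transitivity (\int[mu]_x \int[mu]_h K x h)%E.
  apply: eq_integral => x _.
  pose F (x1 : R) := (`|f x1 - f x| ^+ 2 / `|x1 - x| ^+ 2)%:E.
  have mF : measurable_fun [set: R] F.
    apply/measurable_EFinP; apply: measurable_funM.
      apply: measurable_funX; apply: measurableT_comp => //.
      by apply: measurable_funB => //; exact: mf.
    apply: (measurableT_comp measurable_inv); apply: measurable_funX.
    by apply: measurableT_comp => //; exact: measurable_funB.
  have F0 x1 : (0 <= F x1)%E by rewrite lee_fin divr_ge0 ?sqr_ge0.
  rewrite -(ge0_integral_preserving _ (lebesgue_measure_shift x) mF F0); last exact: measurable_funD.
  apply: eq_integral => h _; rewrite /F /K addrK !real_normK ?num_real//.
  by rewrite (addrC h).
rewrite tonelli_swap//.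
pose J h t := ((2 * sin (pi * t * h)) ^+ 2 / h ^+ 2 * eta t ^+ 2)%:E.
have mJ : measurable_fun [set: measurableTypeR R * measurableTypeR R] (fun z => J z.1 z.2).
  apply/measurable_EFinP; apply: measurable_funM; last first.
    by apply: measurable_funX; exact: (measurableT_comp meta).
  apply: measurable_funM.
    apply: measurable_funX; apply: measurable_funM => //.
    apply: (measurableT_comp (continuous_measurable_fun (@continuous_sin R))).
    by apply: measurable_funM => //; exact: measurable_funM.
  by apply: (measurableT_comp measurable_inv); exact: measurable_funX.
have J0 h t : (0 <= J h t)%E by rewrite lee_fin mulr_ge0 ?sqr_ge0// divr_ge0 ?sqr_ge0.
transitivity (\int[mu]_h \int[mu]_t J h t)%E.
  apply: eq_integral => h _.
  have mfh : measurable_fun [set: R] (fun x => f (x + h) - f x).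
    by apply: measurable_funB => //; apply: (measurableT_comp mf); exact: measurable_funD.
  transitivity ((h ^- 2)%:E * N2 mu (fun x => f (x + h) - f x)%R)%E.
    rewrite /N2 -ge0_integralZl//.
    - by apply: eq_integral => x _; rewrite /K mulrC EFinM.
    - exact: measurable_sqr_EFin.
    - by move=> x _; rewrite lee_fin sqr_ge0.
    - by rewrite lee_fin invr_ge0 sqr_ge0.
  rewrite (hartley_pair_N2_shift h hp) -ge0_integralZl//.
  - by apply: eq_integral => t _; rewrite /J -EFinM; congr EFin; ring.
  - apply/measurable_EFinP; apply: measurable_funM; last exact: measurable_funX.
    apply: measurable_funX; apply: measurable_funM => //.
    apply: (measurableT_comp (continuous_measurable_fun (@continuous_sin R))).
    by apply: measurable_funM => //; exact: measurable_funM.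
  - by move=> t _; rewrite lee_fin mulr_ge0 ?sqr_ge0.
  - by rewrite lee_fin invr_ge0 sqr_ge0.
rewrite tonelli_swap// -ge0_integralZl//.
- apply: eq_integral => t _.
  transitivity ((eta t ^+ 2)%:E * \int[mu]_h ((2 * sin (pi * t * h)) ^+ 2 / h ^+ 2)%:E)%E.
    rewrite -ge0_integralZl//.
    + by apply: eq_integral => h _; rewrite /J -EFinM mulrC.
    + apply/measurable_EFinP; apply: measurable_funM.
        by apply: measurable_funX; apply: measurable_funM => //; exact: measurable_sinM.
      by apply: (measurableT_comp measurable_inv); exact: measurable_funX.
    + by move=> h _; rewrite lee_fin divr_ge0 ?sqr_ge0.
    + by rewrite lee_fin sqr_ge0.
  by rewrite integral_sin_sq -!EFinM; congr EFin; ring.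
- by apply/measurable_EFinP; apply: measurable_funM => //; exact: measurable_funX.
- by move=> t _; rewrite lee_fin mulr_ge0 ?sqr_ge0.
- by rewrite lee_fin mulr_ge0 ?sqr_ge0.
Qed.

Lemma integral_damp_halfline (c : R) : 0 < c ->
  (\int[mu]_(y in `]0%R, +oo[) (expR (- (c * y)))%:E = (c^-1)%:E)%E.
Proof.
move=> c0; have cn0 : c != 0 by rewrite gt_eqF.
have mE : measurable_fun [set: R] (fun y : R => expR (- (c * y))).
  apply: continuous_measurable_fun => y.
  by apply: continuous_comp; [apply: cvgN; exact: cvgMr|exact: continuous_expR].
rewrite integral_itv_obnd_cbnd; last by apply/measurable_EFinP; exact: measurable_funTS.
have := integral_expR_1cos 0 c0.
rewrite (_ : (\int[mu]_(t in _) _)%E = (2%:E * \int[mu]_(y in `[0%R, +oo[) (expR (- (c * y)))%:E)%E).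
  move=> h; have := congr1 (fun u => ((2^-1)%:E * u)%E) h.
  rewrite muleA -!EFinM mulVf ?pnatr_eq0// mul1e => ->; congr EFin.
  by field.
rewrite -ge0_integralZl//.
- by apply: eq_integral => t _; rewrite mul0r cos0 -EFinM; congr EFin; ring.
- by apply/measurable_EFinP; exact: measurable_funTS.
Qed.

Definition energy_density eta (p : R * R) :=
  hartley (grad_x eta p.2) p.1 ^+ 2 + hartley (grad_y eta p.2) p.1 ^+ 2.

Lemma measurable_energy_density eta : measurable_fun [set: R] eta ->
  measurable_fun [set: measurableTypeR R * measurableTypeR R] (energy_density eta).
Proof.
move=> meta; pose T := (measurableTypeR R * measurableTypeR R)%type.
have mcas : measurable_fun [set: T * measurableTypeR R] (fun z => cas (2 * pi * z.2 * z.1.1)).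
  apply: (measurableT_comp (@measurable_cas R)).
  apply: measurable_funM; first by apply: measurable_funM.
  exact: (measurableT_comp measurable_fst).
have mdamp : measurable_fun [set: T * measurableTypeR R] (fun z => damp z.1.2 z.2).
  apply: (measurableT_comp (continuous_measurable_fun (@continuous_expR R))).
  apply: measurableT_comp => //; apply: measurable_funM; last exact: measurableT_comp.
  by apply: measurable_funM => //; exact: (measurableT_comp measurable_snd).
apply: measurable_funD; apply: measurable_funX; apply: measurable_Rintegral.
  apply: measurable_funM; first exact: mcas.
  apply: measurable_funM; last by apply: (measurableT_comp meta); exact: measurableT_comp.
  apply: measurable_funM => //; apply: measurableT_comp => //.
  exact: measurable_funM.
apply: measurable_funM; first exact: mcas.
apply: measurableT_comp => //; apply: measurable_funM; last exact: (measurableT_comp meta).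
apply: measurable_funM => //; apply: measurable_funM => //.
exact: measurableT_comp.
Qed.

Lemma energy_hartley eta : L2 mu eta ->
  (\int[mu \x mu]_(p in [set p : R * R | (0 < p.2)%R]) (energy_density eta p)%:E =
   (2 * pi)%:E * \int[mu]_t (`|t| * eta t ^+ 2)%:E)%E.
Proof.
move=> l2eta; have [meta _] := l2eta.
pose P : set R := `]0, +oo[%classic.
have inP (y : R) : (y \in P) = (0 < y).
  by apply/idP/idP => [/set_mem|h]; [|apply/mem_set]; rewrite /P/= in_itv/= andbT.
pose i (y : R) : R := \1_P y.
have mi : measurable_fun [set: R] i by apply: measurable_indic; exact: measurable_itv.
have i0 y : 0 <= i y by rewrite /i indicE.
have E0 p : 0 <= energy_density eta p by rewrite addr_ge0 ?sqr_ge0.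
have mE := measurable_energy_density meta.
(* The half plane becomes an indicator factor, so that Tonelli can be applied on the whole plane,
   integrating in [x] first. *)
pose W (p : R * R) := (i p.2 * energy_density eta p)%:E.
have mW : measurable_fun [set: measurableTypeR R * measurableTypeR R] W.
  by apply/measurable_EFinP; apply: measurable_funM => //; exact: (measurableT_comp mi).
have W0 p : (0 <= W p)%E by rewrite lee_fin mulr_ge0.
transitivity (\int[mu \x mu]_p W p)%E.
  rewrite integral_mkcond; apply: eq_integral => p _.
  rewrite patchE /W /i indicE inP; have [h|h] := boolP (0 < p.2).
    by rewrite mem_set// mul1r.
  by rewrite memNset ?mul0r//; exact/negP.
rewrite fubini_tonelli2//.
pose J y t := (i y * (2 * (wdamp y t ^+ 2 * eta t ^+ 2)))%:E.
have mJ : measurable_fun [set: measurableTypeR R * measurableTypeR R] (fun z => J z.1 z.2).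
  apply/measurable_EFinP; apply: measurable_funM; first exact: (measurableT_comp mi).
  apply: measurable_funM => //; apply: measurable_funM; last first.
    by apply: measurable_funX; exact: (measurableT_comp meta).
  apply: measurable_funX; apply: measurable_funM.
    by apply: measurable_funM => //; exact: measurableT_comp.
  apply: (measurableT_comp (continuous_measurable_fun (@continuous_expR R))).
  apply: measurableT_comp => //; apply: measurable_funM; last exact: measurableT_comp.
  exact: measurable_funM.
have J0 y t : (0 <= J y t)%E.
  by rewrite lee_fin mulr_ge0// mulr_ge0// mulr_ge0 ?sqr_ge0.
have mwe y : measurable_fun [set: R] (fun t => (wdamp y t ^+ 2 * eta t ^+ 2)%:E).
  apply/measurable_EFinP; apply: measurable_funM; last exact: measurable_funX.
  by apply: measurable_funX; exact: measurable_wdamp.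
transitivity (\int[mu]_y \int[mu]_t J y t)%E.
  apply: eq_integral => y _; rewrite /fubini_G /W /J /=.
  rewrite /i indicE inP; have [y0|y0] /= := ltP 0 y; last first.
    by under eq_integral do rewrite mul0r; under [in RHS]eq_integral do rewrite mul0r.
  under eq_integral do rewrite mul1r; under [in RHS]eq_integral do rewrite mul1r EFinM.
  rewrite ge0_integralZl//; [|exact: mwe|by move=> t _; rewrite lee_fin mulr_ge0 ?sqr_ge0].
  rewrite -N2_grad_y.
  have [lx1 lx2] := (L1_grad_x l2eta y0, L2_grad_x l2eta y0).
  have [ly1 ly2] := (L1_grad_y l2eta y0, L2_grad_y l2eta y0).
  have -> : (2%:E * N2 mu (grad_y eta y) = N2 mu (hartley (grad_x eta y)) +
      N2 mu (hartley (grad_y eta y)))%E.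
    rewrite !hartley_N2// (N2_grad_x l2eta) -mule2n.
    by rewrite muleC -[in RHS]mule_natl muleC.
  rewrite /N2 -ge0_integralD//.
  - by move=> x _; rewrite lee_fin sqr_ge0.
  - by apply: measurable_sqr_EFin; exact: measurable_hartley.
  - by move=> x _; rewrite lee_fin sqr_ge0.
  - by apply: measurable_sqr_EFin; exact: measurable_hartley.
rewrite tonelli_swap// -ge0_integralZl//.
- apply: eq_integral => t _ /=.
  have [->|t0] := eqVneq t 0.
    rewrite normr0 mul0r mule0; apply: integral0_eq => y _.
    by rewrite /J /wdamp normr0 !(mulr0, mul0r, expr0n).
  have c0 : 0 < 4 * pi * `|t| by rewrite !mulr_gt0 ?pi_gt0// normr_gt0.
  (* Here [8 * pi ^ 2 = 2 * (2 * pi) ^ 2], the leading 2 counting both partial derivatives; dividing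
     by the rate [4 * pi * |t|] leaves [2 * pi * |t|]. That rate must be positive, so [t = 0] was
     treated apart. *)
  transitivity (\int[mu]_(y in P) ((8 * pi ^+ 2 * `|t| ^+ 2 * eta t ^+ 2)%:E *
      (expR (- (4 * pi * `|t| * y)))%:E))%E.
    rewrite [RHS]integral_mkcond; apply: eq_integral => y _.
    rewrite patchE /J /i indicE; case: ifPn => _; rewrite ?mul0r// mul1r -EFinM.
    rewrite /wdamp /damp (_ : - (4 * pi * `|t| * y) = - (2 * pi * y * `|t|) + - (2 * pi * y * `|t|)); last by ring.
    by rewrite expRD; congr EFin; ring.
  rewrite ge0_integralZl//.
  + rewrite integral_damp_halfline// -!EFinM; congr EFin.
    have p0 : pi != 0 :> R by rewrite gt_eqF// pi_gt0.
    have t1 : `|t| != 0 by rewrite normr_eq0.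
    by move: (pi) `|t| p0 t1 => p r p0 r0; field; rewrite p0 r0.
  + exact: measurable_itv.
  + apply/measurable_EFinP; apply: measurable_funTS; apply: continuous_measurable_fun => y.
    by apply: continuous_comp; [apply: cvgN; exact: cvgMr|exact: continuous_expR].
  + by rewrite lee_fin mulr_ge0 ?sqr_ge0// mulr_ge0 ?sqr_ge0// mulr_ge0 ?sqr_ge0.
- by apply/measurable_EFinP; apply: measurable_funM => //; exact: measurable_funX.
- by move=> t _; rewrite lee_fin mulr_ge0 ?sqr_ge0.
- by rewrite lee_fin mulr_ge0 ?pi_ge0.
Qed.

(** The defect [d] equals [- (a_ n - a)(- t) + sg * (a_ n - a)(t)] for every [n], so its norm is
    bounded by quantities tending to 0. *)
Lemma limit_parity (sg : R) (a_ : nat -> R -> R) (a : R -> R) :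
  sg ^+ 2 = 1 -> (forall n t, a_ n (- t) = sg * a_ n t) ->
  (forall n, measurable_fun [set: R] (a_ n)) -> measurable_fun [set: R] a ->
  N2 mu (fun t => a_ n t - a t) @[n --> \oo] --> 0%E ->
  {ae mu, forall t, a (- t) = sg * a t}.
Proof.
move=> sg2 a_sg ma_ ma a0; pose d t := a (- t) - sg * a t.
have md : measurable_fun [set: R] d.
  apply: measurable_funB; first by apply: (measurableT_comp ma).
  exact: measurable_funM.
have le4 n : (N2 mu d <= 4%:E * N2 mu (fun t => a_ n t - a t)%R)%E.
  have mn : measurable_fun [set: R] (fun t => a_ n t - a t) by exact: measurable_funB.
  have m1 : measurable_fun [set: R] (fun t => -1 * (a_ n (- t) - a (- t))).
    by apply: measurable_funM => //; exact: (measurableT_comp mn).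
  have m2 : measurable_fun [set: R] (fun t => sg * (a_ n t - a t)) by exact: measurable_funM.
  have := N2D_le mu m1 m2.
  rewrite (_ : (fun t => -1 * _ + _) = d); last first.
    by apply/funext => t; rewrite /d a_sg; ring.
  move=> /le_trans; apply.
  rewrite (_ : N2 mu (fun t => -1 * _) = N2 mu (fun t => a_ n (- t) - a (- t))); last first.
    by apply: eq_integral => t _; rewrite mulN1r sqrrN.
  rewrite (_ : N2 mu (fun t => sg * _) = N2 mu (fun t => a_ n t - a t)); last first.
    by apply: eq_integral => t _; rewrite exprMn sg2 mul1r.
  rewrite (N2_preserving _ (@lebesgue_measure_preimageN R) mn)//.
  by rewrite -ge0_muleDl ?lee_fin// -EFinD (_ : 2 + 2 = 4 :> R)//; ring.
have d0 : N2 mu d = 0%E.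
  have h := @cvg0_N2_le _ _ _ mu (fun=> d) (fun n t => a_ n t - a t) 4 le4 a0.
  by apply: (cvg_unique _ _ h) => //; exact: cvg_cst.
have := (ae_eq_integral_abs mu measurableT (measurable_sqr_EFin md)).1.
rewrite (_ : (\int[mu]_(x in _) _)%E = N2 mu d); last first.
  by apply: eq_integral => t _; rewrite gee0_abs// lee_fin sqr_ge0.
move=> /(_ d0); apply: negligibleS => t /=; apply: contra_not => /(_ I) [] /eqP.
by rewrite sqrf_eq0 subr_eq0 => /eqP.
Qed.

(** Reflection exchanges [(a + b)^2] and [(a - b)^2], and their sum is [2 (a^2 + b^2)]. This avoids
    the cross term [|t| * a * b], which need not be integrable. *)
Lemma parity_norm_sq (a b : R -> R) : measurable_fun [set: R] a -> measurable_fun [set: R] b ->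
  {ae mu, forall t, a (- t) = a t} -> {ae mu, forall t, b (- t) = - b t} ->
  (\int[mu]_t (`|t| * (a t + b t) ^+ 2)%:E = \int[mu]_t (`|t| * (a t ^+ 2 + b t ^+ 2))%:E)%E.
Proof.
move=> ma mb ae_a ae_b.
have mt : measurable_fun [set: R] (fun t : R => `|t|) by [].
pose W t := `|t| * (a t - b t) ^+ 2; pose V t := `|t| * (a t + b t) ^+ 2.
pose U t := `|t| * (a t ^+ 2 + b t ^+ 2).
have mW : measurable_fun [set: R] (fun t => (W t)%:E).
  by apply/measurable_EFinP; apply: measurable_funM => //; apply: measurable_funX; exact: measurable_funB.
have mV : measurable_fun [set: R] (fun t => (V t)%:E).
  by apply/measurable_EFinP; apply: measurable_funM => //; apply: measurable_funX; exact: measurable_funD.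
have mU : measurable_fun [set: R] (fun t => (U t)%:E).
  by apply/measurable_EFinP; apply: measurable_funM => //; apply: measurable_funD; exact: measurable_funX.
have W0 t : (0 <= (W t)%:E)%E by rewrite lee_fin mulr_ge0 ?sqr_ge0.
have V0 t : (0 <= (V t)%:E)%E by rewrite lee_fin mulr_ge0 ?sqr_ge0.
have U0 t : (0 <= (U t)%:E)%E by rewrite lee_fin mulr_ge0// addr_ge0 ?sqr_ge0.
have WV : (\int[mu]_t (W t)%:E = \int[mu]_t (V t)%:E)%E.
  rewrite -(ge0_integral_preserving _ (@lebesgue_measure_preimageN R) mW W0)//.
  apply: ge0_ae_eq_integral => //; first exact: (measurableT_comp mW).
  apply: (negligibleS _ (negligibleU ae_a ae_b)) => t /=.
  apply: contra_notP => /not_orP[/contrapT at_ /contrapT bt] _.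
  by rewrite /W /V at_ bt normrN opprK.
have : (2%:E * \int[mu]_t (V t)%:E = 2%:E * \int[mu]_t (U t)%:E)%E.
  rewrite -[RHS]ge0_integralZl// mule_natl mule2n -{2}WV -ge0_integralD//.
  by apply: eq_integral => t _; rewrite -EFinM -EFinD; congr EFin; rewrite /V /W /U; ring.
move=> h; have := congr1 (fun u => ((2^-1)%:E * u)%E) h.
by rewrite !muleA -!EFinM mulVf ?pnatr_eq0// !mul1e.
Qed.

End dirichlet_energy.

(** * The complex derivative and the gradient *)

Section cauchy_riemann.
Context (R : realType).
Notation Re := (@complex.Re R).
Notation Im := (@complex.Im R).
Implicit Types (z w h l : R[i]) (x y r d e : R).

Lemma sqr_normc z : Normc.normc z ^+ 2 = Re z ^+ 2 + Im z ^+ 2.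
Proof. by case: z => a b; rewrite /= sqr_sqrtr// addr_ge0 ?sqr_ge0. Qed.

Lemma Re_le_normc z : `|Re z| <= Normc.normc z.
Proof.
case: z => a b /=; rewrite -sqrtr_sqr ler_sqrt ?addr_ge0 ?sqr_ge0//.
by rewrite lerDl sqr_ge0.
Qed.

Lemma Im_le_normc z : `|Im z| <= Normc.normc z.
Proof.
case: z => a b /=; rewrite -sqrtr_sqr ler_sqrt ?addr_ge0 ?sqr_ge0//.
by rewrite lerDr sqr_ge0.
Qed.

Lemma normcE z : `|z| = (Normc.normc z)%:C.
Proof. by []. Qed.

(** The order on [R[i]] is partial and a positive element has no imaginary part; radii of complex
    balls are thus real. *)
Lemma gt0_complex (d : R[i]) : 0 < d -> 0 < Re d /\ d = (Re d)%:C.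
Proof.
by case: d => a b; rewrite ltcE /= => /andP[/eqP -> a0].
Qed.

Lemma nbhs_complexP (z : R[i]^o) (P : set R[i]^o) : nbhs z P ->
  exists2 d : R, 0 < d & forall w, Normc.normc (z - w) < d -> P w.
Proof.
move=> /nbhs_ballP[d /= /gt0_complex[d0 dE] dP].
exists (Re d) => // w wd; apply: dP; rewrite /ball/= normcE dE ltcR.
exact: wd.
Qed.

Lemma nbhs_upper_half_plane (z : R[i]^o) : upper_half_plane R z ->
  nbhs z (upper_half_plane R : set R[i]^o).
Proof.
rewrite /upper_half_plane /= => z0; apply/nbhs_ballP; exists (Im z)%:C => /=.
  by rewrite ltcR.
move=> w; rewrite /ball/= normcE ltcR => h.
have := le_lt_trans (Im_le_normc (z - w)) h.
case: z w z0 {h} => a b [c d] /= b0; rewrite ltr_distlC /=; lra.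
Qed.

Lemma cvg_dnbhs_complex (g : R[i]^o -> R[i]^o) l : g h @[h --> 0^'] --> (l : R[i]^o) ->
  forall e, 0 < e -> exists2 d, 0 < d &
    forall h, h != 0 -> Normc.normc h < d -> Normc.normc (l - g h) < e.
Proof.
move=> /cvgrPdist_lt gl e e0.
have /nbhs_complexP[d d0 dP] : \forall h \near (0 : R[i]^o)^', `|l - g h| < e%:C.
  by apply: gl; rewrite ltcR.
exists d => // h h0 hd; rewrite -ltcR; apply: dP => //.
by rewrite sub0r; move: hd; rewrite /= -!ltcR -!normcE normrN.
Qed.

Section complex_derivative.
Variables (u v : R[i] -> R) (F : R[i] -> R[i]).
Hypothesis FE : forall z, upper_half_plane R z -> F z = u z +i* v z.
Hypothesis hol : holomorphic_on (upper_half_plane R) (fun z => u z +i* v z).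

(** [F] is prescribed only on the half plane, so differentiability is transferred along equality
    near [z]. The epsilon-delta form then allows increments along either axis. *)
Lemma complex_derive_cvg z : upper_half_plane R z ->
  forall e, 0 < e -> exists2 d, 0 < d &
    forall h, h != 0 -> Normc.normc h < d ->
      Normc.normc (complex_derive F z - h^-1 * (F (h + z) - F z)) < e.
Proof.
move=> Hz; have := hol Hz.
have nF : \forall w \near (z : R[i]^o), (fun z => u z +i* v z : R[i]^o) w = F w.
  by apply: filterS (nbhs_upper_half_plane Hz) => w /FE ->.
move=> /(near_eq_derivable nF) /cvg_ex[l hl].
have hl' : h^-1 *: ((F : R[i]^o -> R[i]^o) (h + z) - F z) @[h --> (0 : R[i]^o)^'] --> (l : R[i]^o).
  move: hl; apply: cvg_trans; apply: near_eq_cvg; near=> h => /=.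
  by rewrite (_ : h *: (1 : R[i]^o) = h)//; exact: mulr1.
have -> : complex_derive F z = l by exact: (cvg_lim _ hl').
exact: cvg_dnbhs_complex hl'.
Unshelve. all: by end_near. Qed.

Lemma partial_x_complex_derive z : upper_half_plane R z ->
  partial_x u z = Re (complex_derive F z).
Proof.
move=> Hz; apply: cvg_lim => //; apply/cvgrPdist_lt => e e0.
have [d d0 dP] := complex_derive_cvg Hz e0.
near=> r.
have r0 : r != 0 by near: r; exact: nbhs_dnbhs_neq.
have rd : `|r| < d by near: r; exact: dnbhs0_lt.
have h0 : r%:C != 0 :> R[i] by rewrite -[0]/(0%:C) (inj_eq (@complexI R)).
have nr : Normc.normc r%:C = `|r| by rewrite /= expr0n addr0 sqrtr_sqr.
have := dP _ h0; rewrite nr => /(_ rd); apply: le_lt_trans.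
apply: le_trans (Re_le_normc _).
set X := r%:C^-1 * _.
have E : r%:C * X = F (r%:C + z) - F z by rewrite /X mulVKf.
have Hrz : upper_half_plane R (r%:C + z) by move: Hz; case: (z) => a b; rewrite /upper_half_plane/= add0r.
have ReX : r * Re X = u (r%:C + z) - u z.
  have := congr1 Re E; rewrite (FE Hrz) (FE Hz); case: (X) => a b /=.
  by rewrite mul0r subr0.
have -> : Re (complex_derive F z - X) = Re (complex_derive F z) - Re X.
  by case: (complex_derive F z) (X) => a b [c e'].
rewrite (_ : r^-1 *: _ = Re X)//.
apply: (mulfI r0); rewrite ReX -[_ *: _]/(r^-1 * _) mulVKf//.
by case: (z) => a b /=; rewrite -[r%:C + _]/((r + a) +i* (0 + b)) add0r.
Unshelve. all: by end_near. Qed.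

(** Along [h = i r], the real part of [h * X] is [- r * Im X]. With the companion for [x] this is
    [F' = u_x - i u_y], the Cauchy-Riemann equations in terms of [u] alone. *)
Lemma partial_y_complex_derive z : upper_half_plane R z ->
  partial_y u z = - Im (complex_derive F z).
Proof.
move=> Hz; apply: cvg_lim => //; apply/cvgrPdist_lt => e e0.
have [d d0 dP] := complex_derive_cvg Hz e0.
have z0 : 0 < Im z := Hz.
near=> r.
have r0 : r != 0 by near: r; exact: nbhs_dnbhs_neq.
have rd : `|r| < d by near: r; exact: dnbhs0_lt.
(* Vertical increments can leave the half plane; this keeps [h + z] inside, where [F] is known. *)
have rz : `|r| < Im z by near: r; exact: dnbhs0_lt.
pose h : R[i] := 0 +i* r.
have h0 : h != 0 by rewrite eq_complex /= negb_and r0 orbT.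
have nr : Normc.normc h = `|r| by rewrite /= expr0n add0r sqrtr_sqr.
have := dP _ h0; rewrite nr => /(_ rd); apply: le_lt_trans.
apply: le_trans (Im_le_normc _).
set X := h^-1 * _.
have E : h * X = F (h + z) - F z by rewrite /X mulVKf.
have Hrz : upper_half_plane R (h + z).
  move: (z0) (rz); case: (z) => a b; rewrite /upper_half_plane/= ltr_norml; lra.
have ImX : r * Im X = - (u (h + z) - u z).
  have := congr1 Re E; rewrite (FE Hrz) (FE Hz); case: (X) => a b /=.
  by rewrite mul0r sub0r => <-; rewrite opprK.
have -> : Im (complex_derive F z - X) = Im (complex_derive F z) - Im X.
  by case: (complex_derive F z) (X) => a b [c e'].
rewrite (_ : r^-1 *: _ = - Im X).
  by rewrite -opprD normrN.
apply: (mulfI r0); rewrite mulrN ImX opprK -[_ *: _]/(r^-1 * _) mulVKf//.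
by rewrite /h; case: (z) => a b /=; rewrite -[_ + (a +i* b)]/((0 + a) +i* (r + b)) add0r.
Unshelve. all: by end_near. Qed.

Lemma grad_norm_sq_complex_derive z : upper_half_plane R z ->
  Normc.normc (complex_derive F z) ^+ 2 = grad_norm_sq u z.
Proof.
move=> Hz; rewrite sqr_normc /grad_norm_sq partial_x_complex_derive//.
by rewrite partial_y_complex_derive// sqrrN.
Qed.

End complex_derivative.
End cauchy_riemann.

(** * From the Fourier transform to the Hartley transform *)

Section fourier.
Context (R : realType).
Notation mu := (@lebesgue_measure R).
Notation Re := (@complex.Re R).
Notation Im := (@complex.Im R).

Lemma hartley_fourierL1 (g : R -> R) t : L1 mu g ->
  hartley g t = Re (fourierL1 g t) + Im (fourierL1 g t).
Proof.
move=> lg.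
have b (k : R -> R) : measurable_fun [set: R] k -> (forall a, `|k a| <= 1) ->
    L1 mu (fun x => k (2 * pi * x * t) * g x).
  move=> mk k1; apply: (@L1_bdd _ _ _ mu _ 1 _ _ _ lg) => [|x]; last exact: k1.
  apply: (measurableT_comp mk).
  by apply: measurable_funM => //; exact: measurable_funM.
rewrite /= -RintegralD//.
- by apply: eq_Rintegral => x _; rewrite /cas mulrDl.
- apply: (b cos); first exact: continuous_measurable_fun (@continuous_cos R).
  by move=> a; rewrite ler_norml cos_geN1 cos_le1.
- apply: (b sin); first exact: continuous_measurable_fun (@continuous_sin R).
  by move=> a; rewrite ler_norml sin_geN1 sin_le1.
Qed.

Lemma measurable_fourierL1 (g : R -> R) : measurable_fun [set: R] g ->
  measurable_fun [set: R] (fun t => Re (fourierL1 g t)) /\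
  measurable_fun [set: R] (fun t => Im (fourierL1 g t)).
Proof.
move=> mg; split; apply: measurable_Rintegral;
  (apply: measurable_funM; last exact: (measurableT_comp mg)).
  apply: (measurableT_comp (continuous_measurable_fun (@continuous_cos R))).
  by apply: measurable_funM => //; exact: measurable_funM.
apply: (measurableT_comp (continuous_measurable_fun (@continuous_sin R))).
by apply: measurable_funM => //; exact: measurable_funM.
Qed.

Lemma fourierL1_parity (g : R -> R) t : L1 mu g ->
  Re (fourierL1 g (- t)) = 1 * Re (fourierL1 g t) /\
  Im (fourierL1 g (- t)) = -1 * Im (fourierL1 g t).
Proof.
move=> lg; split => /=.
  by rewrite mul1r; apply: eq_Rintegral => x _; rewrite mulrN cosN.
rewrite -RintegralZl//; first by apply: eq_Rintegral => x _; rewrite mulrN sinN; ring.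
apply: (@L1_bdd _ _ _ mu _ 1 _ _ _ lg) => [|x]; last by rewrite ler_norml sin_geN1 sin_le1.
apply: (measurableT_comp (continuous_measurable_fun (@continuous_sin R))).
by apply: measurable_funM => //; exact: measurable_funM.
Qed.

Section transform.
Variables (f : R -> R) (fh : R -> R[i]).
Hypothesis hfh : is_fourier_transform f fh.

Let a t := Re (fh t).
Let b t := Im (fh t).

Let l2a : L2 mu a. Proof. by case: hfh => _ h _ _; exact: LfunL2. Qed.
Let l2b : L2 mu b. Proof. by case: hfh => _ _ h _; exact: LfunL2. Qed.

Let approximation : exists phi : nat -> R -> R,
  [/\ forall n, L1 mu (phi n), forall n, L2 mu (phi n),
      N2 mu (fun x => phi n x - f x) @[n --> \oo] --> 0%E,
      N2 mu (fun t => Re (fourierL1 (phi n) t) - a t) @[n --> \oo] --> 0%E &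
      N2 mu (fun t => Im (fourierL1 (phi n) t) - b t) @[n --> \oo] --> 0%E].
Proof.
case: hfh => _ _ _ [phi [l1 l2 phif phifh]]; exists phi.
have l1' n : L1 mu (phi n) by exact/Lfun1_integrable.
have [[ma _] [mb _]] := (l2a, l2b).
have m_ n := measurable_fourierL1 (L1_measurable (l1' n)).
have mRe n : measurable_fun [set: R] (fun t => Re (fourierL1 (phi n) t) - a t).
  by apply: measurable_funB => //; have [] := m_ n.
have mIm n : measurable_fun [set: R] (fun t => Im (fourierL1 (phi n) t) - b t).
  by apply: measurable_funB => //; have [] := m_ n.
have nE n t : Normc.normc (fourierL1 (phi n) t - fh t) ^+ 2 =
    (Re (fourierL1 (phi n) t) - a t) ^+ 2 + (Im (fourierL1 (phi n) t) - b t) ^+ 2.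
  by rewrite sqr_normc /a /b; case: (fourierL1 _ _) (fh t) => c d [c' d'].
have mn n : measurable_fun [set: R] (fun t => (Normc.normc (fourierL1 (phi n) t - fh t) ^+ 2)%:E).
  apply/measurable_EFinP; rewrite (funext (nE n)).
  by apply: measurable_funD; exact: measurable_funX.
have bound (g : nat -> R -> R) : (forall n, measurable_fun [set: R] (g n)) ->
    (forall n t, g n t ^+ 2 <= Normc.normc (fourierL1 (phi n) t - fh t) ^+ 2) ->
    N2 mu (g n) @[n --> \oo] --> 0%E.
  move=> mg gle.
  apply: (@squeeze_cvge _ _ _ _ (cst 0%E) _ _ _ _ _ phifh); last exact: cvg_cst.
  apply: nearW => n; rewrite N2_ge0 /=; apply: ge0_le_integral => //.
  - by move=> t _; rewrite lee_fin sqr_ge0.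
  - by apply: measurable_sqr_EFin; exact: mg.
  - exact: mn.
  - by move=> t _; rewrite lee_fin gle.
split => //.
- by move=> n; exact: LfunL2.
- move: phif; rewrite (_ : (fun n => _) = (fun n => N2 mu (fun x => phi n x - f x)))//.
  by apply/funext => n; apply: eq_integral => x _; rewrite real_normK ?num_real.
- by apply: bound => // n t; rewrite nE lerDl sqr_ge0.
- by apply: bound => // n t; rewrite nE lerDr sqr_ge0.
Qed.

Lemma fourier_hartley_pair : hartley_pair f (fun t => Re (fh t) + Im (fh t)).
Proof.
case: hfh => lf _ _ _; have [phi [l1 l2 phif phia phib]] := approximation.
split; [exact: LfunL2|exact: L2D|exists phi; split => //].
have [[ma _] [mb _]] := (l2a, l2b).
apply: (@squeeze_cvge _ _ _ _ (cst 0%E) _ (fun n =>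
    2%:E * N2 mu (fun t => (Re (fourierL1 (phi n) t) - a t)%R) +
    2%:E * N2 mu (fun t => (Im (fourierL1 (phi n) t) - b t)%R))%E).
- apply: nearW => n; rewrite N2_ge0 /=.
  have [mRe mIm] := measurable_fourierL1 (L1_measurable (l1 n)).
  have := N2D_le mu (measurable_funB mRe ma) (measurable_funB mIm mb).
  apply: le_trans; rewrite le_eqVlt; apply/predU1P; left.
  by apply: eq_integral => t _; rewrite hartley_fourierL1//; congr EFin; rewrite /a /b /=; ring.
- exact: cvg_cst.
- rewrite -[X in _ --> X]adde0 -(mule0 2%:E); apply: cvgeD => //.
  by apply: cvgeZl.
  by apply: cvgeZl.
Qed.

(** The even and odd parities of the real and imaginary parts hold everywhere for [phi n], and
    almost everywhere for their L2 limit [fh]. *)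
Lemma integral_norm_fourier :
  (\int[mu]_t (`|t| * (Re (fh t) + Im (fh t)) ^+ 2)%:E =
   \int[mu]_t (`|t| * Normc.normc (fh t) ^+ 2)%:E)%E.
Proof.
have [phi [l1 l2 phif phia phib]] := approximation.
have [[ma _] [mb _]] := (l2a, l2b).
have m_ n := measurable_fourierL1 (L1_measurable (l1 n)).
have ae_a : {ae mu, forall t, a (- t) = 1 * a t}.
  apply: (limit_parity _ _ _ ma phia); first by rewrite expr1n.
    by move=> n t; have [] := fourierL1_parity t (l1 n).
  by move=> n; have [] := m_ n.
have ae_b : {ae mu, forall t, b (- t) = -1 * b t}.
  apply: (limit_parity _ _ _ mb phib); first by rewrite sqrrN expr1n.
    by move=> n t; have [] := fourierL1_parity t (l1 n).
  by move=> n; have [] := m_ n.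
rewrite (parity_norm_sq ma mb).
- by apply: eq_integral => t _; rewrite sqr_normc.
- by apply: negligibleS ae_a => t; rewrite /= mul1r.
- by apply: negligibleS ae_b => t; rewrite /= mulN1r.
Qed.

End transform.

Lemma extension_boundary_function (u : R[i] -> R) (f eta : R -> R) x y :
  boundary_function u f -> hartley_pair f eta -> 0 < y ->
  u (x +i* y) = extension eta x y.
Proof.
case=> lf uE hp y0; have l2f := LfunL2 lf; rewrite uE// /poisson_integral.
rewrite /extension -(hartley_pair_poisson hp x y0) -RintegralZl//.
  by apply: eq_Rintegral => s _; rewrite /poisson_kernel mulrA.
have l2pk : L2 mu (fun s => poisson_kernel y (x - s)).
  have l1 : L1 mu (fun s => poisson_kernel y (x - s)).
    have := L1_shift (- x) (L1_poisson_kernel y0); under eq_fun do rewrite -poisson_kernelN opprB.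
    exact.
  by apply: (@L1_bdd_L2 _ _ _ mu (pi^-1 * y^-1)) => // s; exact: poisson_kernel_le.
have p0 : pi != 0 :> R by rewrite gt_eqF// pi_gt0.
have := L1Z pi (L2M l2pk l2f).
by under eq_fun do rewrite /poisson_kernel !mulrA mulfV// mul1r.
Qed.

Lemma grad_norm_sq_extension (u : R[i] -> R) (f eta : R -> R) (p : R * R) :
  boundary_function u f -> hartley_pair f eta -> 0 < p.2 ->
  grad_norm_sq u (of_pair p) = energy_density eta p.
Proof.
move=> bf hp; case: p => x y /= y0; have [_ l2eta _] := hp.
have ux : partial_x u (x +i* y) = hartley (grad_x eta y) x.
  rewrite -(derive1_extension_x l2eta x y0) /partial_x /=.
  have -> : (fun s => u (s +i* y)) = (fun s => extension eta s y); last by [].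
  by apply/funext => s; exact: extension_boundary_function bf hp y0.
have uy : partial_y u (x +i* y) = hartley (grad_y eta y) x.
  rewrite -(derive1_extension_y l2eta x y0) /partial_y /= !derive1E.
  (* The Poisson formula covers positive heights only, so in the vertical direction the two
     functions agree merely near [y]. *)
  apply: near_eq_derive; near=> s.
  apply: (extension_boundary_function _ bf hp); near: s.
  exact: lt_nbhsr.
by rewrite /grad_norm_sq /energy_density /of_pair /= ux uy.
Unshelve. all: by end_near. Qed.

End fourier.

Theorem theorem4p1 (R : realType) (u : R[i] -> R) (f : R -> R)
    (fh : R -> R[i]) (F : R[i] -> R[i])
    (hu : h2 u) (hf : boundary_function u f)
    (hfh : is_fourier_transform f fh) (hF : canonical_holomorphic u F) :
  [/\ area_integral (upper_half_plane R) (grad_norm_sq u)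
      = ((2 * pi)%:E * \int[lebesgue_measure]_t
           ((`|t| * Normc.normc (fh t) ^+ 2)%:E))%E,
      ((2 * pi)%:E * \int[lebesgue_measure]_t
           ((`|t| * Normc.normc (fh t) ^+ 2)%:E))%E
      = area_integral (upper_half_plane R)
          (fun z => Normc.normc (complex_derive F z) ^+ 2) &
      area_integral (upper_half_plane R)
          (fun z => Normc.normc (complex_derive F z) ^+ 2)
      = (((2 * pi)^-1)%:E * \int[lebesgue_measure]_x2 \int[lebesgue_measure]_x1
           ((`|f x1 - f x2| ^+ 2 / `|x1 - x2| ^+ 2)%:E))%E].
Proof.
have hp := fourier_hartley_pair hfh; have [_ l2eta _] := hp.
have energy : area_integral (upper_half_plane R) (grad_norm_sq u) =
    ((2 * pi)%:E * \int[lebesgue_measure]_t ((`|t| * Normc.normc (fh t) ^+ 2)%:E))%E.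
  rewrite -(integral_norm_fourier hfh) -(energy_hartley l2eta).
  apply: eq_integral => p; rewrite inE /= => p0; congr EFin.
  exact: grad_norm_sq_extension hf hp p0.
have dF : area_integral (upper_half_plane R) (fun z => Normc.normc (complex_derive F z) ^+ 2) =
    area_integral (upper_half_plane R) (grad_norm_sq u).
  case: hF => v [_ hol] FE; apply: eq_integral => p; rewrite inE /= => p0; congr EFin.
  exact: grad_norm_sq_complex_derive FE hol _ p0.
split; [exact: energy|by rewrite dF energy|].
(* What remains is the identity of constants [2 * pi = (2 * pi)^-1 * (4 * pi ^ 2)]. *)
rewrite dF energy (douglas_hartley hp) -(integral_norm_fourier hfh) muleA -EFinM.
congr (_%:E * _)%E.
have p0 : pi != 0 :> R by rewrite gt_eqF// pi_gt0.
by move: (pi) p0 => p p0; field.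
Qed.
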